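(* Let $m\in\mathbb{N}$, $1 \leq p,q_1, \dots, q_m, r \leq \infty$ and $\vec q=(q_1,\dots,q_m)$. Then, for each $n \in \mathbb{N}$, $$k_{q_1,p}^{(n)}(r) \cdots k_{q_m,p}^{(n)}(r) \leq k_{\vec q,p}^{(n)}(r).$$ Consequently, $k_{q_1,p}(r) \cdots k_{q_m,p}(r) \leq k_{\vec q,p}(r)$. Moreover, if $p=r$ then equality holds.
   Context: All measures are $\sigma$-finite and all $L^p$ spaces are real. For $m\in\mathbb{N}$, $1\le q_1,\dots,q_m,p,r\le\infty$ and $\vec q=(q_1,\dots,q_m)$, the constant $k_{\vec q,p}(r)\in[1,\infty]$ is the infimum of all $C\ge 1$ such that for all $\sigma$-finite measures $\mu_1,\dots,\mu_m,\nu$, all bounded $m$-linear operators $T\colon L^{q_1}(\mu_1)\times\cdots\times L^{q_m}(\mu_m)\to L^p(\nu)$, all $n_1,\dots,n_m\in\mathbb{N}$ and all functions $\{f^i_{k_i}\}_{k_i=1}^{n_i}\subset L^{q_i}(\mu_i)$ ($1\le i\le m$), $$\left\| \left(\sum_{k_1, \dots, k_m} |T(f_{k_1}^1, \dots, f_{k_m}^m)|^r\right)^{1/r}\right\|_{L^p(\nu)} \leq C \|T\| \prod_{i=1}^m \left\| \left(\sum_{k_i=1}^{n_i} |f_{k_i}^i|^r\right)^{1/r} \right\|_{L^{q_i}(\mu_i)}$$ (with the supremum in place of the $r$-sums when $r=\infty$); $k_{\vec q,p}(r)=\infty$ if no such $C$ exists. For $n\in\mathbb{N}$, $k^{(n)}_{\vec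 q,p}(r)\in[1,\infty)$ is the infimum of all $C\ge 0$ for which the inequality holds for all such measures, operators and functions with $n_1=\cdots=n_m=n$. For a single exponent $q$, $k_{q,p}(r)$ and $k^{(n)}_{q,p}(r)$ denote the same constants with $m=1$ (linear operators $T\colon L^q(\mu)\to L^p(\nu)$). *)

(* Defs.v *)
From mathcomp Require Import all_boot all_order all_algebra.
From mathcomp Require Import all_classical all_reals all_analysis.

Set Implicit Arguments.
Unset Strict Implicit.
Unset Printing Implicit Defensive.

Import Order.TTheory GRing.Theory Num.Theory.
Import numFieldNormedType.Exports.

Local Open Scope classical_set_scope.
Local Open Scope ring_scope.
Local Open Scope ereal_scope.

(* $(\sum_k |a_k|^r)^{1/r}$, and $\max_k |a_k|$ for $r = \infty$; the value at
   -oo is irrelevant, since only exponents $r \ge 1$ occur. *)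
Definition lr_norm (R : realType) (I : finType) (r : \bar R) (a : I -> R) : R :=
  match r with
  | s%:E => ((\sum_(k : I) `|a k| `^ s) `^ s^-1)%R
  | +oo => (\big[Num.max/0]_(k : I) `|a k|)%R
  | -oo => 0%R
  end.

Section multilinear_operators.
Context (R : realType) (m : nat).
Context (d : 'I_m -> measure_display) (X : forall i, measurableType (d i)).
Context (mu : forall i, {measure set (X i) -> \bar R}).
Context (d' : measure_display) (Y : measurableType d').
Context (nu : {measure set Y -> \bar R}).
Context (q : 'I_m -> \bar R) (p : \bar R).
Context (q1 : forall i, 1 <= q i) (p1 : 1 <= p).
Implicit Type (T : (forall i, LspaceType (mu i) (q1 i)) -> LspaceType nu p1).

(* LspaceType is a type of classes of functions modulo a.e. equality, which the
   library does not equip with a linear structure. Hence the identity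
   T(.., a u + v, ..) = a T(.., u, ..) + T(.., v, ..) is stated with h the tuple
   whose i-th component is the class of a u + v, and the equalities of classes
   are written as a.e. equalities of their representatives. *)
Definition multilinear_op T : Prop :=
  forall (i : 'I_m) (a : R) (f g h : forall j, LspaceType (mu j) (q1 j)),
    (forall j, j != i -> g j = f j /\ h j = f j) ->
    h i = (fun x => a * f i x + g i x)%R %[ae mu i] ->
    T h = (fun y => a * T f y + T g y)%R %[ae nu].

Definition bounded_op T : Prop :=
  exists M : R, forall f : forall i, LspaceType (mu i) (q1 i),
    'N[nu]_p[EFin \o T f] <= M%:E * \prod_(i < m) 'N[mu i]_(q i)[EFin \o f i].

Definition op_norm T : \bar R :=
  ereal_sup [set 'N[nu]_p[EFin \o T f] |
    f in [set f : forall i, LspaceType (mu i) (q1 i) |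
      forall i, 'N[mu i]_(q i)[EFin \o f i] <= 1]].

End multilinear_operators.

Section constants.
Context (R : realType) (m : nat) (q : 'I_m -> \bar R) (p : \bar R).
Context (q1 : forall i, 1 <= q i) (p1 : 1 <= p) (r : \bar R).

Definition vector_ineq (N : 'I_m -> nat) (C : R) : Prop :=
  forall (d : 'I_m -> measure_display) (X : forall i, measurableType (d i))
    (mu : forall i, {sigma_finite_measure set (X i) -> \bar R})
    (d' : measure_display) (Y : measurableType d')
    (nu : {sigma_finite_measure set Y -> \bar R})
    (T : (forall i, LspaceType (mu i) (q1 i)) -> LspaceType nu p1),
    multilinear_op T -> bounded_op T ->
    forall f : forall i, 'I_(N i) -> LspaceType (mu i) (q1 i),
      'N[nu]_p[EFin \o (fun y => lr_norm r
          (fun k : {dffun forall i, 'I_(N i)} => T (fun i => f i (k i)) y))]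
      <= C%:E * op_norm T *
         \prod_(i < m)
           'N[mu i]_(q i)[EFin \o (fun x => lr_norm r (fun k => f i k x))].

(* ereal_inf of the empty set is +oo, so kconst = +oo if no C is admissible. *)
Definition kconst : \bar R :=
  ereal_inf [set C%:E | C in [set C : R | (1 <= C)%R /\
    forall N : 'I_m -> nat, (forall i, (0 < N i)%N) -> vector_ineq N C]].

Definition kconstn (n : nat) : \bar R :=
  ereal_inf [set C%:E | C in [set C : R | (0 <= C)%R /\
    vector_ineq (fun=> n) C]].

End constants.

Section single_exponent.
Context (R : realType) (q p : \bar R) (q1 : 1 <= q) (p1 : 1 <= p) (r : \bar R).

Definition kconst1 : \bar R := kconst (fun _ : 'I_1 => q1) p1 r.
Definition kconstn1 (n : nat) : \bar R := kconstn (fun _ : 'I_1 => q1) p1 r n.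

End single_exponent.

(* Main.v *)
(** For the inequality, choose for each i an operator T_i from L^(q_i)(mu_i) to
    L^p(nu_i) and functions f^i showing that c_i < k_(q_i,p). The operator
    (g_1, .., g_m) |-> T_1 g_1 (x) .. (x) T_m g_m with values in
    L^p(nu_1 x .. x nu_m) has norm at most the product of the norms of the T_i,
    and both sides of its vector-valued inequality factor over i; hence
    c_1 .. c_m is at most any constant admissible for m-linear operators.

    If p = r < oo, the p-th power of the left-hand side is the sum over
    (k_1, .., k_m) of the p-th powers of the norms of T (f^1_(k_1), .., f^m_(k_m)).
    Freezing all variables but the i-th one, a finite family of linear operators
    into L^p(nu) is a single linear operator into L^p(nu x counting), to which the
    scalar inequality with constant c_i applies; doing this for one variable after
    the other yields the constant c_1 .. c_m. If p = r = oo, the constant 1 is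
    admissible, and every admissible constant is at least 1. *)

Require Import Defs.
From HB Require Import structures.
From mathcomp Require Import all_boot all_order all_algebra.
From mathcomp Require Import all_classical all_reals all_analysis.
From mathcomp Require Import ess_sup_inf measurable_realfun.

Set Implicit Arguments.
Unset Strict Implicit.
Unset Printing Implicit Defensive.

Import Order.TTheory GRing.Theory Num.Theory.
Import numFieldNormedType.Exports.

Local Open Scope classical_set_scope.
Local Open Scope ring_scope.
Local Open Scope ereal_scope.

(** * Mixed norms of finite families *)

Section lr_norm.
Context (R : realType).
Implicit Types r : \bar R.

Variant ge1_spec : \bar R -> Prop :=
  | Ge1Fin s of (1 <= s)%R : ge1_spec s%:E
  | Ge1Infty : ge1_spec +oo.

Lemma ge1P r : 1 <= r -> ge1_spec r.
Proof. by case: r => [s||//]; rewrite ?lee_fin; constructor. Qed.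

Lemma lr_norm_ge0 r (I : finType) (a : I -> R) : (0 <= lr_norm r a)%R.
Proof.
case: r => [s||] //=; first exact: powR_ge0.
by apply: bigmax_ge_id.
Qed.

Lemma le_lr_norm r (I : finType) (a b : I -> R) : 1 <= r ->
  (forall k, `|a k| <= `|b k|)%R -> (lr_norm r a <= lr_norm r b)%R.
Proof.
case/ge1P => [s s1|] ab /=; last first.
  by apply: le_bigmax2 => k _; exact: ab.
have s0 : (0 <= s)%R by rewrite (le_trans _ s1).
apply: ge0_ler_powR; rewrite ?invr_ge0 ?nnegrE//.
- by apply: sumr_ge0 => k _; exact: powR_ge0.
- by apply: sumr_ge0 => k _; exact: powR_ge0.
- by apply: ler_sum => k _; apply: ge0_ler_powR; rewrite ?nnegrE.
Qed.

Lemma eq_lr_norm r (I : finType) (a b : I -> R) :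
  a =1 b -> lr_norm r a = lr_norm r b.
Proof. by move=> /funext ->. Qed.

Lemma lr_normZ r (I : finType) (c : R) (a : I -> R) : 1 <= r ->
  (lr_norm r (fun k => c * a k) = `|c| * lr_norm r a)%R.
Proof.
case/ge1P => [s s1|] /=; last first.
  under eq_bigr do rewrite normrM.
  by rewrite (big_endo ( *%R `|c|))//= ?mulr0// => x y; rewrite maxr_pMr.
have s0 : (0 < s)%R by rewrite (lt_le_trans _ s1).
under eq_bigr do rewrite normrM powRM//.
rewrite -mulr_sumr powRM ?powR_ge0//; last first.
  by rewrite sumr_ge0// => k _; exact: powR_ge0.
by rewrite -powRrM mulfV ?gt_eqF// powRr1.
Qed.

Lemma ler_lr_norm r (I : finType) (a : I -> R) (k : I) : 1 <= r ->
  (`|a k| <= lr_norm r a)%R.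
Proof.
case/ge1P => [s s1|] /=; last first.
  exact: (le_bigmax _ (fun k => `|a k|%R)).
have s0 : (0 < s)%R by rewrite (lt_le_trans _ s1).
rewrite -[leLHS](@powRr1 R)// -(mulfV (lt0r_neq0 s0)) powRrM.
apply: ge0_ler_powR; rewrite ?nnegrE ?powR_ge0//.
- by rewrite invr_ge0 ltW.
- by apply: sumr_ge0 => ? _; exact: powR_ge0.
by rewrite (bigD1 k)//= lerDl sumr_ge0// => ? _; exact: powR_ge0.
Qed.

(** Every [|a k|] is at most their sum, so monotonicity compares [a] with a constant family and
    homogeneity extracts the sum. *)
Lemma lr_norm_le_sum r (I : finType) (a : I -> R) : 1 <= r ->
  (lr_norm r a <= lr_norm r (fun _ : I => 1) * \sum_k `|a k|)%R.
Proof.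
move=> r1; have S0 : (0 <= \sum_k `|a k|)%R by rewrite sumr_ge0.
rewrite -{1}(ger0_norm S0) mulrC -lr_normZ//; apply: le_lr_norm => // k.
by rewrite mulr1 (ger0_norm S0) (bigD1 k)//= lerDl sumr_ge0.
Qed.

Lemma lr_norm_gt0 r (I : finType) (a : I -> R) (k : I) : 1 <= r ->
  (a k != 0)%R -> (0 < lr_norm r a)%R.
Proof. by move=> r1 ak; rewrite (lt_le_trans _ (ler_lr_norm a k r1))// normr_gt0. Qed.

Lemma lr_norm_bij r (I J : finType) (h : J -> I) (a : I -> R) : bijective h ->
  lr_norm r (a \o h) = lr_norm r a.
Proof.
move=> bh; case: r => [s||] //=.
  by congr (_ `^ _)%R; rewrite [RHS](reindex h)//; exact: onW_bij.
case: bh => g gK hK; apply/eqP; rewrite eq_le; apply/andP; split.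
  apply: bigmax_le; first exact: bigmax_ge_id.
  by move=> i _; exact: (le_bigmax _ (fun k => `|a k|%R)).
apply: bigmax_le; first exact: bigmax_ge_id.
move=> i _; rewrite -[in leLHS](hK i).
exact: (le_bigmax _ (fun k => `|a (h k)|%R)).
Qed.

(** Distributivity when the range ['I_(N i)] depends on [i]: dependent functions are transported to
    [fprod], where the claim becomes non-dependent distributivity over tagged pairs. *)
Lemma big_dffun_distr (I : finType) (N : I -> nat) (a : forall i, 'I_(N i) -> R) :
  (\sum_(k : {dffun forall i, 'I_(N i)}) \prod_i a i (k i) =
   \prod_i \sum_k a i k)%R.
Proof.
pose T_ i : finType := 'I_(N i).
transitivity (\sum_(t : fprod T_) \prod_(i : I) [ffun k => a i k] (t i))%R.
  rewrite (reindex (@dffun_of_fprod I T_)); last first.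
    exact/onW_bij/dffun_of_fprod_bij.
  by apply: eq_bigr => t _; apply: eq_bigr => i _; rewrite !ffunE.
rewrite (@big_fprod _ _ _ _ _ I T_ (fun i => [ffun k : T_ i => a i k])).
rewrite -(bigA_distr_big_dep (fun i => tagged_with T_ i)
   (fun i g => untag 0%R [ffun k : T_ i => a i k] g)) /=.
apply: eq_bigr => i _.
rewrite -(@big_tag _ _ _ _ T_ (fun i => [ffun k : T_ i => a i k]))/=.
by apply: eq_bigr => k _; rewrite ffunE.
Qed.

End lr_norm.

Section lr_norm_families.
Context (R : realType).
Implicit Types r : \bar R.

Lemma powR_prod (I : Type) (l : seq I) (F : I -> R) (s : R) :
  (forall i, 0 <= F i)%R -> (\prod_(i <- l) F i `^ s = (\prod_(i <- l) F i) `^ s)%R.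
Proof.
move=> F0; elim: l => [|i l ih]; first by rewrite !big_nil powR1.
by rewrite !big_cons powRM ?prodr_ge0// ih.
Qed.

(** For finite [r] this is distributivity applied to the powers. For [r = +oo] the maximisers of the
    single coordinates combine into one multi-index. *)
Lemma lr_norm_prod r (I : finType) (N : I -> nat) (a : forall i, 'I_(N i) -> R) :
  1 <= r -> (forall i, (0 < N i)%N) ->
  (lr_norm r (fun k : {dffun forall i, 'I_(N i)} => \prod_i a i (k i)) =
   \prod_i lr_norm r (a i))%R.
Proof.
case/ge1P => [s s1|] N0 /=; last first.
  under eq_bigr do rewrite normr_prod.
  apply/eqP; rewrite eq_le; apply/andP; split.
    apply: bigmax_le => [|k _].
      by apply: prodr_ge0 => i _; exact: bigmax_ge_id.
    apply: ler_prod => i _; rewrite normr_ge0/=.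
    exact: (le_bigmax _ (fun k => `|a i k|%R)).
  (* The maximum starts from the default 0; it is attained because ['I_(N i)] is inhabited and
     absolute values are at least 0. *)
  have mx i : {k | (\big[Num.max/0]_k `|a i k| = `|a i k|)%R}.
    have [] := @eq_bigmax _ _ _ 0%R (Ordinal (N0 i)) predT (fun k => `|a i k|%R).
    - by [].
    - by move=> k _; exact: normr_ge0.
    - by move=> k _ ->; exists k.
  pose k := [ffun i => projT1 (mx i)] : {dffun forall i, 'I_(N i)}.
  apply: le_trans (le_bigmax _ (fun k : {dffun forall i, 'I_(N i)} =>
    \prod_i `|a i (k i)|)%R k).
  apply: ler_prod => i _; rewrite bigmax_ge_id/= /k ffunE.
  by case: (mx i) => /= ? <-.
under eq_bigr do rewrite normr_prod -powR_prod//.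
rewrite (big_dffun_distr (fun i k => `|a i k| `^ s)%R).
rewrite powR_prod// => i.
by apply: sumr_ge0 => k _; exact: powR_ge0.
Qed.

Lemma measurable_lr_norm d (T : measurableType d) (I : finType) r
    (F : I -> T -> R) : (forall k, measurable_fun setT (F k)) ->
  measurable_fun setT (fun x => lr_norm r (F ^~ x)).
Proof.
move=> mF; case: r => [s| |] /=; last exact: measurable_cst.
- suff mS : measurable_fun setT (fun x => \sum_k `|F k x| `^ s)%R.
    exact: (measurableT_comp (measurable_powR _) mS).
  apply: measurable_sum => k.
  have mFk : measurable_fun setT (fun x => `|F k x|%R) by exact: measurableT_comp.
  exact: (measurableT_comp (measurable_powR _) mFk).
- elim: (index_enum I) => [|k l ih].
    by under eq_fun do rewrite big_nil; exact: measurable_cst.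
  under eq_fun do rewrite big_cons.
  by apply: measurable_maxr => //; exact: measurableT_comp.
Qed.

End lr_norm_families.

(** * Products of extended reals approximated factor by factor *)

Section ereal_products.
Context (R : realType).
Implicit Types (x y K : \bar R).

(** Multiplication by [x] is continuous from below at [K], also when [K] or [x] is infinite. *)
Lemma ge0_mule_ltP K x y : 0 < K -> 0 <= x ->
  (forall c : R, (0 <= c)%R -> c%:E < K -> c%:E * x <= y) -> K * x <= y.
Proof.
case: K => [k| |//] k0 x0 h; last first.
  have y0 : 0 <= y by rewrite (le_trans _ (h 0%R _ _))// mul0e.
  have [->|xn0] := eqVneq x 0; first by rewrite mule0.
  case: x x0 h xn0 => [a| |//]; last first.
    move=> _ h _; have := h 1%R ler01 (ltry _).
    by rewrite mul1e leye_eq => /eqP ->.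
  rewrite lee_fin => a0 h an0.
  have {}a0 : (0 < a)%R by rewrite lt0r a0 andbT; move: an0; rewrite eqe.
  case: y y0 h => [b| |//]; last by move=> *; exact: leey.
  rewrite lee_fin => b0 h.
  (* For [K = +oo] and finite [y = b], this constant would give [b + 1 <= b]. *)
  have c0 : (0 <= (b + 1) / a)%R by rewrite divr_ge0 ?(ltW a0)// addr_ge0.
  have := h _ c0 (ltry _); rewrite -EFinM divfK ?gt_eqF// lee_fin.
  by rewrite gerDl leNgt ltr01.
rewrite lte_fin in k0.
(* For finite [K = k] the constants [t * k] with [0 < t < 1] suffice. *)
apply/lee_mul01Pr; first by rewrite mule_ge0// lee_fin ltW.
move=> t /andP[t0 t1]; rewrite muleA -EFinM; apply: h.
  by rewrite mulr_ge0// ltW.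
by rewrite lte_fin gtr_pMl.
Qed.

(** Induction on [s]: the head factor [K i] is first absorbed into [x], then approximated from below
    with the other [c j] fixed. This is why the statement carries a general [x]. *)
Lemma prode_le_approx (I : eqType) (s : seq I) (K : I -> \bar R) x y :
  uniq s -> (forall i, i \in s -> 0 < K i) -> 0 <= x ->
  (forall c : I -> R, (forall i, i \in s -> (0 <= c i)%R /\ (c i)%:E < K i) ->
     \prod_(i <- s) (c i)%:E * x <= y) ->
  \prod_(i <- s) K i * x <= y.
Proof.
elim: s x => [|i s ih] x /= => [_ _ _ /(_ (fun=> 0%R))|/andP[si us] K0 x0 h].
  by rewrite !big_nil; apply.
rewrite big_cons (muleC (K i)) -muleA; apply: ih => //.
- by move=> j js; apply: K0; rewrite inE js orbT.
- by rewrite mule_ge0// ltW// K0// inE eqxx.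
move=> c hc; rewrite muleCA; apply: ge0_mule_ltP.
- by rewrite K0// inE eqxx.
- rewrite mule_ge0//; rewrite big_seq_cond; apply: prode_ge0 => j.
  by rewrite andbT lee_fin => /hc[].
move=> c0 c00 c0K; rewrite muleA.
pose c' j := if j == i then c0 else c j.
have <- : \prod_(j <- s) (c' j)%:E = \prod_(j <- s) (c j)%:E.
  apply: eq_big_seq => j js; rewrite /c'; case: eqVneq => // ji.
  by rewrite -ji js in si.
have c'i : c' i = c0 by rewrite /c' eqxx.
have := h c'; rewrite big_cons c'i; apply => j.
by rewrite inE /c'; case: eqVneq => [->//|ji /= js]; exact: hc.
Qed.

(** Dual induction for infima. The lower bounds 1 keep the accumulated factor positive, so that one
    may divide by it and no product of 0 and [+oo] arises. *)
Lemma prode_ge_approx (I : eqType) (s : seq I) (A : I -> set R) x y :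
  uniq s -> (forall i c, A i c -> (1 <= c)%R) -> 1 <= y ->
  (forall c : I -> R, (forall i, i \in s -> A i (c i)) ->
     x <= \prod_(i <- s) (c i)%:E * y) ->
  x <= \prod_(i <- s) ereal_inf [set c%:E | c in A i] * y.
Proof.
move=> + A1; elim: s y => [|i s ih] y /= => [_ _ /(_ (fun=> 0%R))|/andP[si us] y1 h].
  by rewrite !big_nil; apply.
have K1 : 1 <= ereal_inf [set c%:E | c in A i].
  by apply: le_ereal_inf_tmp => _ [c Ac <-]; rewrite lee_fin; exact: A1 Ac.
(* The infimum over [A i] joins [y]; both being at least 1, so is their product. *)
rewrite big_cons (muleC (ereal_inf _)) -muleA; apply: ih => //.
  by rewrite -(mule1 1) lee_pmul.
move=> c hc; rewrite muleCA; set z := _ * y.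
have z1 : 1 <= z.
  have p1 : 1 <= \prod_(j <- s) (c j)%:E.
    rewrite prodEFin lee_fin big_seq_cond.
    elim/big_ind: _ => //; first exact: mulr_ege1.
    by move=> j; rewrite andbT => /hc /A1.
  by rewrite /z (le_trans p1)// lee_pemulr// (le_trans _ p1).
have hz (c0 : R) : A i c0 -> x <= c0%:E * z.
  move=> Ac0; rewrite /z muleA.
  pose c' j := if j == i then c0 else c j.
  have <- : \prod_(j <- s) (c' j)%:E = \prod_(j <- s) (c j)%:E.
    apply: eq_big_seq => j js; rewrite /c'; case: eqVneq => // ji.
    by rewrite -ji js in si.
  have c'i : c' i = c0 by rewrite /c' eqxx.
have := h c'; rewrite big_cons c'i; apply => j.
  by rewrite inE /c'; case: eqVneq => [->//|ji /= js]; exact: hc.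
clearbody z; case: z z1 hz => [z| |//]; last first.
  by rewrite gt0_muley ?leey// (lt_le_trans lte01).
rewrite lee_fin => z1 hz; have z0 : (0 < z)%R by rewrite (lt_le_trans _ z1).
rewrite -lee_pdivrMr//; apply: le_ereal_inf_tmp => _ [c0 Ac0 <-].
by rewrite lee_pdivrMr// hz.
Qed.

End ereal_products.

(** * Lp norms and Lp spaces *)

Lemma measurable_power (R : realType) d (T : measurableType d) (s : R)
    (f : T -> R) : measurable_fun setT f ->
  measurable_fun setT (fun x => (`|f x| `^ s)%:E).
Proof.
move=> mf; apply/measurable_EFinP.
have mf' : measurable_fun setT (fun x => `|f x|%R) by exact: measurableT_comp.
exact: (measurableT_comp (measurable_powR _) mf').
Qed.

Section Lnorm_facts.
Context (R : realType) d (T : measurableType d) (mu : {measure set T -> \bar R}).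
Context (p : \bar R) (p1 : 1 <= p).
Implicit Types f g : T -> R.

Local Notation "'N f" := ('N[mu]_p[EFin \o f]) (at level 10, f at level 8).

Lemma le_Lnorm f g : measurable_fun setT f -> measurable_fun setT g ->
  {ae mu, forall x, `|f x| <= `|g x|}%R -> 'N f <= 'N g.
Proof.
move=> mf mg fg; rewrite unlock; case/ge1P: p1 => [s s1|] /=; last first.
  case: ifPn => // _; apply: le_ess_sup; apply: filterS fg => x /=.
  by rewrite lee_fin.
have s0 : (0 <= s)%R by rewrite (le_trans _ s1).
have ip (h : T -> R) : 0 <= \int[mu]_x (`|h x| `^ s)%:E.
  by apply: integral_ge0 => x _; rewrite lee_fin powR_ge0.
apply: gt0_ler_poweR.
- by rewrite invr_ge0.
- by rewrite in_itv/= leey andbT ip.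
- by rewrite in_itv/= leey andbT ip.
apply: ae_ge0_le_integral => //=.
- exact: measurable_power.
- exact: measurable_power.
- apply: filterS fg => x fgx _; rewrite lee_fin.
  by apply: ge0_ler_powR; rewrite ?nnegrE.
Qed.

Lemma ae_eq_Lnorm f g : measurable_fun setT f -> measurable_fun setT g ->
  {ae mu, forall x, f x = g x} -> 'N f = 'N g.
Proof.
move=> mf mg fg; apply/eqP; rewrite eq_le.
by apply/andP; split; apply: le_Lnorm => //; apply: filterS fg => x ->.
Qed.

Lemma Lnorm_scale (c : R) f : measurable_fun setT f ->
  'N (fun x => c * f x)%R = `|c|%:E * 'N f.
Proof.
move=> mf; rewrite unlock; case/ge1P: p1 => [s s1|] /=; last first.
  case: ifPn => [mu0|_]; last by rewrite mule0.
  rewrite -ess_supZl//; apply/eq_ess_sup/nearW => x /=.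
  by rewrite normrM EFinM.
have s0 : (0 < s)%R by rewrite (lt_le_trans _ s1).
under eq_integral do rewrite normrM powRM// EFinM.
rewrite ge0_integralZl_EFin//.
- rewrite poweRM ?integral_ge0//.
  by rewrite poweR_EFin -powRrM mulfV ?gt_eqF// powRr1.
- exact: measurable_power.
Qed.

Lemma Lnorm_sum (I : Type) (l : seq I) (F : I -> T -> R) :
  (forall i, measurable_fun setT (F i)) ->
  'N (fun x => \sum_(i <- l) F i x)%R <= \sum_(i <- l) 'N (F i).
Proof.
move=> mF; elim: l => [|i l ih].
  rewrite big_nil (_ : EFin \o _ = cst 0).
    by rewrite Lnorm0// gt_eqF// (lt_le_trans lte01).
  by apply/funext => x /=; rewrite big_nil.
rewrite big_cons; apply: le_trans (leeD (lexx _) ih).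
have -> : (fun x => \sum_(j <- i :: l) F j x)%R =
    (F i \+ (fun x => \sum_(j <- l) F j x))%R.
  by apply/funext => x; rewrite big_cons.
by apply: eminkowski => //; exact: measurable_sum.
Qed.

Lemma Lnorm_norm f : 'N (fun x => `|f x|)%R = 'N f.
Proof. by rewrite -[RHS]Lnorm_abse. Qed.

(** A crude bound whose constant depends on [I]; it serves to show that mixed norms are finite, or
    that they vanish. *)
Lemma Lnorm_lr_norm_le (r : \bar R) (I : finType) (F : I -> T -> R) : 1 <= r ->
  (forall i, measurable_fun setT (F i)) ->
  'N (fun x => lr_norm r (F ^~ x)) <= (lr_norm r (fun _ : I => 1))%:E * \sum_i 'N (F i).
Proof.
move=> r1 mF; set c := lr_norm _ (fun=> 1%R).
have c0 : (0 <= c)%R by exact: lr_norm_ge0.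
have mS : measurable_fun setT (fun x => \sum_i `|F i x|)%R.
  by apply: measurable_sum => i; exact: measurableT_comp.
apply: (@le_trans _ _ ('N (fun x => c * \sum_i `|F i x|)%R)).
  apply: le_Lnorm.
  - exact: measurable_lr_norm.
  - exact: measurable_funM.
  - apply: nearW => x; rewrite !ger0_norm ?lr_norm_ge0//.
      exact: lr_norm_le_sum.
    by rewrite mulr_ge0// sumr_ge0.
rewrite Lnorm_scale// ger0_norm// lee_wpmul2l ?lee_fin//.
under [leRHS]eq_bigr do rewrite -Lnorm_norm.
by apply: Lnorm_sum => i; exact: measurableT_comp.
Qed.

Lemma Lnorm_le_lr_norm (r : \bar R) (I : finType) (F : I -> T -> R) (i : I) :
  1 <= r -> (forall i, measurable_fun setT (F i)) ->
  'N (F i) <= 'N (fun x => lr_norm r (F ^~ x)).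
Proof.
move=> r1 mF; apply: le_Lnorm => //; first exact: measurable_lr_norm.
apply: nearW => x; rewrite [leRHS]ger0_norm ?lr_norm_ge0//.
exact: (ler_lr_norm (F ^~ x)).
Qed.

End Lnorm_facts.

Section Lspace_facts.
Context (R : realType) d (T : measurableType d) (mu : {measure set T -> \bar R}).
Context (p : \bar R) (p1 : 1 <= p).

Lemma measurable_aeEqMfun (f : {mfun_ mu, T >-> measurableTypeR R}) :
  measurable_fun setT (f : T -> R).
Proof.
rewrite /aqEqMfun_to_fun; move: (repr _) => g.
exact: (measurable_funP g).
Qed.

Lemma measurable_Lspace (f : LspaceType mu p1) : measurable_fun setT (f : T -> R).
Proof. exact: measurable_aeEqMfun. Qed.

Lemma Lnorm_Lspace_lty (f : LspaceType mu p1) : 'N[mu]_p[EFin \o f] < +oo.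
Proof. exact: (@Lebesgue_finite _ _ _ _ _ p1). Qed.

Lemma Lnorm_Lspace_fin_num (f : LspaceType mu p1) :
  'N[mu]_p[EFin \o f] \is a fin_num.
Proof. by rewrite ge0_fin_numE ?Lnorm_ge0// Lnorm_Lspace_lty. Qed.

(** The representative chosen for the class of [f] agrees with [f] only almost everywhere, whence
    the form of the conclusion. *)
Lemma LspaceP (f : T -> R) : measurable_fun setT f -> 'N[mu]_p[EFin \o f] < +oo ->
  exists h : LspaceType mu p1, {ae mu, forall x, h x = f x}.
Proof.
move=> mf Nf.
pose F : {mfun T >-> measurableTypeR R} :=
  HB.pack f (isMeasurableFun.Build _ _ T (measurableTypeR R) f mf).
pose h : {mfun_ mu, T >-> measurableTypeR R} := \pi%qT F.
have hf : {ae mu, forall x, h x = f x}.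
  have /eqP : (repr h = F %[mod {mfun_ mu, T >-> measurableTypeR R}])%qT.
    by rewrite reprK.
  by rewrite eqmodE => /asboolP; apply: filterS => x; apply.
have Nh : finite_norm mu p h.
  by rewrite /finite_norm (@ae_eq_Lnorm _ _ _ _ _ p1 _ f)//; exact: measurable_aeEqMfun.
pose H : LspaceType mu p1 := HB.pack h (isFinLebesgue.Build _ _ _ _ _ p1 h Nh).
by exists H.
Qed.

End Lspace_facts.

(** * Bounded multilinear operators *)

Lemma lee_prod (R : realDomainType) (I : Type) (s : seq I) (f g : I -> \bar R) :
  (forall i, 0 <= f i) -> (forall i, f i <= g i) ->
  \prod_(i <- s) f i <= \prod_(i <- s) g i.
Proof.
move=> f0 fg; elim: s => [|i s ih]; first by rewrite !big_nil.
by rewrite !big_cons; apply: lee_pmul => //; exact: prode_ge0.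
Qed.

Section Lspace_families.
Context (R : realType) d (T : measurableType d) (mu : {measure set T -> \bar R}).
Context (p : \bar R) (p1 : 1 <= p) (r : \bar R) (r1 : 1 <= r).

Lemma Lspace_zero : exists h : LspaceType mu p1, {ae mu, forall x, h x = 0%R}.
Proof.
apply: LspaceP; first exact: measurable_cst.
by rewrite Lnorm0// gt_eqF// (lt_le_trans lte01).
Qed.

Lemma Lspace_scale (c : R) (f : LspaceType mu p1) :
  exists h : LspaceType mu p1, {ae mu, forall x, h x = c * f x}%R.
Proof.
have mf := measurable_Lspace f.
apply: LspaceP; first exact: measurable_funM.
rewrite Lnorm_scale//.
by rewrite lte_mul_pinfty ?lee_fin// Lnorm_Lspace_lty.
Qed.

Lemma Lnorm_lr_norm_lty (I : finType) (F : I -> LspaceType mu p1) :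
  'N[mu]_p[EFin \o (fun x => lr_norm r (fun k => F k x))] < +oo.
Proof.
apply: (le_lt_trans (Lnorm_lr_norm_le _ p1 r1 _)) => [i|].
  exact: measurable_Lspace.
rewrite lte_mul_pinfty ?lee_fin ?lr_norm_ge0//.
by apply: lte_sum_pinfty => i _; exact: Lnorm_Lspace_lty.
Qed.

Lemma Lnorm_Lspace_le (I : finType) (F : I -> LspaceType mu p1) (i : I) :
  'N[mu]_p[EFin \o F i] <=
  'N[mu]_p[EFin \o (fun x => lr_norm r (fun k => F k x))].
Proof.
have mF k : measurable_fun setT (F k : T -> R) by exact: measurable_Lspace.
exact: (@Lnorm_le_lr_norm _ _ _ _ _ p1 r I (fun k => F k : T -> R) i r1 mF).
Qed.

End Lspace_families.

Section multilinear_op_facts.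
Context (R : realType) (m : nat).
Context (d : 'I_m -> measure_display) (X : forall i, measurableType (d i)).
Context (mu : forall i, {measure set (X i) -> \bar R}).
Context (d' : measure_display) (Y : measurableType d').
Context (nu : {measure set Y -> \bar R}).
Context (q : 'I_m -> \bar R) (p : \bar R).
Context (q1 : forall i, 1 <= q i) (p1 : 1 <= p).
Context (T : (forall i, LspaceType (mu i) (q1 i)) -> LspaceType nu p1).
Implicit Types f g h : forall i, LspaceType (mu i) (q1 i).

Local Notation "''Nq' i f" := ('N[mu i]_(q i)[EFin \o f])
  (at level 10, i at level 8, f at level 8).
Local Notation "''Np' f" := ('N[nu]_p[EFin \o f]) (at level 10, f at level 8).

(** Homogeneity is the defining identity with scalar [c - 1] and both vectors equal to [f]. *)
Lemma multilinear_opZ (i : 'I_m) (c : R) f h : multilinear_op T ->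
  (forall j, j != i -> h j = f j) ->
  {ae mu i, forall x, h i x = c * f i x}%R ->
  {ae nu, forall y, T h y = c * T f y}%R.
Proof.
move=> lT hf hfi.
have h1 j : j != i -> f j = f j /\ h j = f j by move=> /hf ->.
have h2 : h i = (fun x => (c - 1) * f i x + f i x)%R %[ae mu i].
  by apply: filterS hfi => x -> _; rewrite mulrBl mul1r subrK.
have := lT i (c - 1)%R f f h h1 h2.
by apply: filterS => y /(_ Logic.I) ->; rewrite mulrBl mul1r subrK.
Qed.

(** A supremum over the empty set would be [-oo]; the tuple of zero functions shows that the unit
    ball is inhabited. *)
Lemma op_norm_ge0 : 0 <= op_norm T.
Proof.
have z i := cid (Lspace_zero (mu i) (q1 i)).
apply: (le_trans (Lnorm_ge0 nu p (EFin \o T (fun i => projT1 (z i))))).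
apply: ereal_sup_ubound; exists (fun i => projT1 (z i)) => // i.
case: (z i) => /= h h0; rewrite (@ae_eq_Lnorm _ _ _ _ _ (q1 i) _ (cst 0%R))//.
- by rewrite Lnorm0 ?lee01// gt_eqF// (lt_le_trans lte01).
- exact: measurable_Lspace.
Qed.

Lemma op_norm_lty : bounded_op T -> op_norm T < +oo.
Proof.
(* [bounded_op] puts no sign on [M]; a nonnegative constant is required to use that the product of
   norms is at most 1. *)
move=> [M bT]; apply: (@le_lt_trans _ _ (Num.max M 0%R)%:E); last exact: ltry.
apply: ge_ereal_sup => _ [f /= f1 <-].
apply: (le_trans (bT f)).
apply: (@le_trans _ _ ((Num.max M 0%R)%:E * \prod_(i < m) 'Nq i (f i))).
  apply: lee_wpmul2r; first by apply: prode_ge0 => i _; exact: Lnorm_ge0.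
  by rewrite lee_fin le_max lexx.
rewrite -[leRHS]mule1; apply: lee_wpmul2l.
  by rewrite lee_fin le_max lexx orbT.
apply: (le_trans (lee_prod _ (fun i => Lnorm_ge0 _ _ _) f1)).
by rewrite big1.
Qed.

Lemma op_norm_fin_num : bounded_op T -> op_norm T \is a fin_num.
Proof. by move=> bT; rewrite ge0_fin_numE ?op_norm_ge0// op_norm_lty. Qed.

(** If some [f i] has norm 0, boundedness makes the left-hand side vanish. Otherwise all variables
    are normalised and the scalars are pulled out of [T]. *)
Lemma le_op_norm f : multilinear_op T -> bounded_op T ->
  'Np (T f) <= op_norm T * \prod_(i < m) 'Nq i (f i).
Proof.
move=> lT bT.
have [[i fi0]|] := pselect (exists i, 'Nq i (f i) = 0).
  have P0 : \prod_(i < m) 'Nq i (f i) = 0 by rewrite (bigD1 i)//= fi0 mul0e.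
  by case: bT => M /(_ f); rewrite P0 !mule0.
move=> /forallNP f0.
pose n i := fine ('Nq i (f i)).
have nE i : 'Nq i (f i) = (n i)%:E.
  by rewrite fineK// Lnorm_Lspace_fin_num.
have n0 i : (0 < n i)%R.
  by rewrite lt0r fine_ge0 ?Lnorm_ge0// andbT -eqe -nE; apply/eqP/f0.
have z i := cid (Lspace_scale (n i)^-1 (f i)).
pose f' i := projT1 (z i).
have f'E i : {ae mu i, forall x, f' i x = (n i)^-1 * f i x}%R := projT2 (z i).
have Nf' i : 'Nq i (f' i) = 1.
  have mf : measurable_fun setT (f i : X i -> R) by exact: measurable_Lspace.
  rewrite (@ae_eq_Lnorm _ _ _ _ _ (q1 i) _ (fun x => (n i)^-1 * f i x)%R)//.
  - rewrite Lnorm_scale// nE -EFinM ger0_norm ?invr_ge0 ?ltW//.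
    by rewrite mulVf// gt_eqF.
  - exact: measurable_Lspace.
  - exact: measurable_funM.
(* Only the variables in [s] are normalised, so that each induction step changes a single
   variable. *)
pose G (s : seq 'I_m) j := if j \in s then f' j else f j.
have key s : uniq s ->
    {ae nu, forall y, T f y = (\prod_(i <- s) n i) * T (G s) y}%R.
  elim: s => [_|i s ih /= /andP[si us]].
    have -> : G [::] = f by [].
    by apply: nearW => y; rewrite big_nil mul1r.
  have step : {ae nu, forall y, T (G s) y = n i * T (G (i :: s)) y}%R.
    apply: (@multilinear_opZ i) => // [j ji|].
      by rewrite /G inE (negbTE ji).
    rewrite /G inE eqxx/= (negbTE si); apply: filterS (f'E i) => x ->.
    by rewrite mulVKf// gt_eqF.
  near=> y; rewrite (near (ih us) y)// (near step y)//.
  by rewrite big_cons mulrCA mulrA.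
have {}key : {ae nu, forall y, T f y = (\prod_(i < m) n i) * T f' y}%R.
  have := key (index_enum _) (index_enum_uniq _).
  have -> // : G (index_enum _) = f'.
  by apply: functional_extensionality_dep => j; rewrite /G mem_index_enum.
have mT g : measurable_fun setT (T g : Y -> R) by exact: measurable_Lspace.
rewrite (ae_eq_Lnorm p1 _ _ key)//; last exact: measurable_funM.
rewrite Lnorm_scale// ger0_norm; last by apply: prodr_ge0 => i _; rewrite ltW.
rewrite muleC -prodEFin; under [in leRHS]eq_bigr do rewrite nE.
apply: lee_wpmul2r; first by apply: prode_ge0 => i _; rewrite lee_fin ltW.
by apply: ereal_sup_ubound; exists f' => // i; rewrite /= Nf'.
Unshelve. all: by end_near. Qed.

End multilinear_op_facts.

(** * Product spaces *)

Section product_space.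
Context (R : realType) d1 d2 (Y : measurableType d1) (Z : measurableType d2).
Context (m1 : {sigma_finite_measure set Y -> \bar R}).
Context (m2 : {sigma_finite_measure set Z -> \bar R}).

(* The canonical s-finite structure of [m1 \x m2] is the one for subprobability
   measures, hence the alias. *)
Definition sprod : set (Y * Z)%type -> \bar R := m1 \x m2.

HB.instance Definition _ := Measure.copy sprod (m1 \x m2).

(** Rectangles of two increasing exhaustions cover the product: a point in [F n] and [G k] lies in
    the rectangle of index [maxn n k]. *)
Let sprod_sigma_finite : sigma_finite setT sprod.
Proof.
have /sigma_finiteP[F [TF ndF Foo]] := sigma_finiteT m1.
have /sigma_finiteP[G [TG ndG Goo]] := sigma_finiteT m2.
exists (fun n => F n `*` G n).
  rewrite -setXTT TF TG predeqE => -[x y]; split; last first.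
    by move=> [n _ []/= ? ?]; split; exists n.
  move=> [/= [n _ Fnx] [k _ Gky]]; exists (maxn n k) => //; split.
  - by move: x Fnx; exact/subsetPset/ndF/leq_maxl.
  - by move: y Gky; exact/subsetPset/ndG/leq_maxr.
move=> k; have [? ?] := Foo k; have [? ?] := Goo k.
split; first exact: measurableX.
by rewrite /sprod product_measure1E// lte_mul_pinfty// ge0_fin_numE.
Qed.

HB.instance Definition _ := Measure_isSigmaFinite.Build _ _ _ sprod
  sprod_sigma_finite.

Lemma sprodE (A : set Y) (B : set Z) : measurable A -> measurable B ->
  sprod (A `*` B) = m1 A * m2 B.
Proof. exact: product_measure1E. Qed.

Local Notation m12 := sprod.

(** A null set times the whole space is null even if that space has infinite measure, since 0 times
    [+oo] is 0. *)
Lemma ae_fst (P : Y -> Prop) : {ae m1, forall y, P y} ->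
  {ae m12, forall z : Y * Z, P z.1}.
Proof.
move=> [N [mN N0 PN]]; exists (N `*` setT); split.
- exact: measurableX.
- by rewrite sprodE// [X in X * _]N0 mul0e.
- by move=> z /= Pz; split => //; exact: PN.
Qed.

Lemma ae_snd (P : Z -> Prop) : {ae m2, forall y, P y} ->
  {ae m12, forall z : Y * Z, P z.2}.
Proof.
move=> [N [mN N0 PN]]; exists (setT `*` N); split.
- exact: measurableX.
- by rewrite sprodE// [X in _ * X]N0 mule0.
- by move=> z /= Pz; split => //; exact: PN.
Qed.

(** For finite [p] this is Tonelli's theorem. For [p = +oo], a product of two superlevel sets of
    positive measure has positive measure. *)
Lemma Lnorm_tensor (p : \bar R) (F : Y -> R) (G : Z -> R) : 1 <= p ->
  measurable_fun setT F -> measurable_fun setT G ->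
  'N[m12]_p[EFin \o (fun z => F z.1 * G z.2)%R] =
  'N[m1]_p[EFin \o F] * 'N[m2]_p[EFin \o G].
Proof.
move=> p1 mF mG.
have mFG : measurable_fun setT (fun z : Y * Z => (F z.1 * G z.2)%R).
  apply: measurable_funM; exact: measurableT_comp.
rewrite unlock; case/ge1P: p1 => [s s1|] /=; last first.
  have mT : m12 setT = m1 setT * m2 setT by rewrite -setXTT sprodE.
  (* The norm with exponent [+oo] is 0 by definition on a space of measure zero, so these cases are
     settled first. *)
  have [m10|] := ltP 0 (m1 setT); last first.
    rewrite le_eqVlt ltNge measure_ge0 orbF => /eqP m10.
    by rewrite mT [X in X * _]m10 mul0e ltxx mul0e.
  have [m20|] := ltP 0 (m2 setT); last first.
    rewrite le_eqVlt ltNge measure_ge0 orbF => /eqP m20.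
    by rewrite mT [X in _ * X]m20 mule0 ltxx mule0.
  rewrite mT mule_gt0//.
  set D := ess_sup _ _; set A := ess_sup _ _; set B := ess_sup _ _.
  have A0 : 0 <= A by apply: ess_sup_gee => //; apply: nearW => y /=; rewrite lee_fin.
  have B0 : 0 <= B by apply: ess_sup_gee => //; apply: nearW => y /=; rewrite lee_fin.
  have D0 : 0 <= D.
    apply: ess_sup_gee; first by rewrite /= mT mule_gt0.
    by apply: nearW => y /=; rewrite lee_fin.
  have FA := ess_sup_ge m1 (abse \o (EFin \o F)).
  have GB := ess_sup_ge m2 (abse \o (EFin \o G)).
  have FGD := ess_sup_ge m12 (abse \o (EFin \o (fun z => F z.1 * G z.2)%R)).
  apply/eqP; rewrite eq_le; apply/andP; split.
    apply/ess_supP; near=> z; rewrite /= normrM EFinM lee_pmul//.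
      by near: z; exact: (ae_fst FA).
    by near: z; exact: (ae_snd GB).
  (* If [D < a * b], the rectangle where [|F| > a] and [|G| > b] is null, hence so is one of its
     sides, contradicting [a < A] or [b < B]. *)
  have AB (a b : R) : (0 <= a)%R -> (0 <= b)%R -> a%:E < A -> b%:E < B ->
      a%:E * b%:E <= D.
    move=> a0 b0 aA bB; rewrite leNgt; apply/negP => Dab.
    pose SA := [set y | (a < `|F y|)%R]; pose SB := [set z | (b < `|G z|)%R].
    have mSA : measurable SA.
      rewrite -[SA]setTI; apply: measurable_fun_ltr => //.
      exact: measurableT_comp.
    have mSB : measurable SB.
      rewrite -[SB]setTI; apply: measurable_fun_ltr => //.
      exact: measurableT_comp.
    have SAB0 : m12 (SA `*` SB) = 0.
      have [N [mN N0 DN]] := FGD.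
      apply: (subset_measure0 _ mN _ N0); first exact: measurableX.
      move=> [y z] [/= ay bz]; apply: DN => /=; apply/negP; rewrite -ltNge.
      rewrite (lt_le_trans Dab)//= -EFinM lee_fin normrM.
      by apply: ler_pM => //; exact: ltW.
    move: SAB0; rewrite sprodE// => /eqP; rewrite mule_eq0.
    case/orP => /eqP m0.
      have : A <= a%:E.
        apply/ess_supP; exists SA; split => // y /= /negP.
        by rewrite lee_fin -ltNge.
      by rewrite leNgt aA.
    have : B <= b%:E.
      apply/ess_supP; exists SB; split => // y /= /negP.
      by rewrite lee_fin -ltNge.
    by rewrite leNgt bB.
  have [->|An0] := eqVneq A 0; first by rewrite mul0e.
  have [->|Bn0] := eqVneq B 0; first by rewrite mule0.
  apply: ge0_mule_ltP => // [|a a0 aA]; first by rewrite lt0e An0.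
  rewrite muleC; apply: ge0_mule_ltP => // [|b b0 bB]; first by rewrite lt0e Bn0.
  by rewrite muleC AB.
have s0 : (0 < s)%R by rewrite (lt_le_trans _ s1).
rewrite -poweRM; last 2 first.
- by apply: integral_ge0 => x _; rewrite lee_fin powR_ge0.
- by apply: integral_ge0 => x _; rewrite lee_fin powR_ge0.
congr (_ `^ _); rewrite fubini_tonelli1//=; last exact: measurable_power.
rewrite /fubini_F -ge0_integralZr//.
- apply: eq_integral => y _ /=; rewrite -ge0_integralZl_EFin ?powR_ge0//.
  + by apply: eq_integral => z _; rewrite normrM powRM.
  + exact: measurable_power.
- exact: measurable_power.
- by apply: integral_ge0 => x _; rewrite lee_fin powR_ge0.
Unshelve. all: by end_near. Qed.

End product_space.

(** The one-point space is both the empty product in [tensor_space] and the test space in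
    [single_ineq_ge1]. *)
Lemma Lnorm_dirac_unit (R : realType) (p : \bar R) (f : unit -> R) : 1 <= p ->
  'N[\d_tt]_p[EFin \o f] = `|f tt|%:E.
Proof.
rewrite unlock; case/ge1P => [s s1|] /=.
  rewrite integral_dirac// diracT mul1e poweR_EFin -powRrM mulfV ?powRr1//.
  by rewrite gt_eqF// (lt_le_trans _ s1).
rewrite diracT lte01; apply: ess_sup_ae_cst.
  by apply: (lt_le_trans lte01); rewrite le_eqVlt; apply/orP; left; apply/eqP/esym/diracT.
by apply: nearW; case.
Qed.

(** A finite product of measure spaces, built by iterated binary products along [s] and described
    only by its coordinate maps [pr]: they are measurable, pull almost-everywhere statements back,
    and make norms multiplicative. *)
Lemma tensor_space (R : realType) (I : eqType) (d : I -> measure_display)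
    (Y : forall i, measurableType (d i))
    (nu : forall i, {sigma_finite_measure set (Y i) -> \bar R})
    (p : \bar R) (s : seq I) : 1 <= p -> uniq s ->
  exists (d' : measure_display) (Z : measurableType d')
    (la : {sigma_finite_measure set Z -> \bar R}) (pr : Z -> forall i, Y i),
  [/\ forall i, i \in s -> measurable_fun setT (pr ^~ i),
      forall i, i \in s -> forall P : Y i -> Prop, {ae nu i, forall y, P y} ->
        {ae la, forall z, P (pr z i)}
    & forall F : forall i, Y i -> R, (forall i, measurable_fun setT (F i)) ->
        'N[la]_p[EFin \o (fun z => \prod_(i <- s) F i (pr z i))%R] =
        \prod_(i <- s) 'N[nu i]_p[EFin \o F i]].
Proof.
move=> p1; elim: s => [_|k s ih /= /andP[ks us]].
  (* Coordinates outside [s] hold the default [point]. *)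
  exists _, unit, \d_tt, (fun _ i => point); split => // F mF.
  by rewrite big_nil Lnorm_dirac_unit// big_nil normr1.
have [d' [Z [la [pr [mpr nupr Npr]]]]] := ih us.
(* The new factor overwrites coordinate [k]; as [k] is not in [s], the earlier coordinates are
   kept. *)
pose pr' (z : Z * Y k) : forall i, Y i := eqtype.dfwith (pr z.1) z.2.
exists _, (Z * Y k)%type, (sprod la (nu k)), pr'.
have prk z : pr' z k = z.2 by rewrite /pr' eqtype.dfwith_in.
have prs z i : i \in s -> pr' z i = pr z.1 i.
  by move=> si; rewrite /pr' eqtype.dfwith_out//; apply: contraNneq ks => ->.
split => [i|i|F mF].
- rewrite inE; case: eqVneq => [-> _|ik /= si].
    have -> : pr' ^~ k = snd by apply/funext.
    exact: measurable_snd.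
  have -> : pr' ^~ i = pr ^~ i \o fst by apply/funext => z /=; rewrite prs.
  exact: (measurableT_comp (mpr i si)).
- rewrite inE; case: eqVneq => [-> _|ik /= si] P hP.
    by apply: filterS (ae_snd la hP) => z; rewrite prk.
  by apply: filterS (ae_fst (nu k) (nupr _ si _ hP)) => z; rewrite prs.
rewrite big_cons muleC -Npr// -Lnorm_tensor//; last first.
  by apply: measurable_prod => i si; apply: measurableT_comp => //; exact: mpr.
congr (Lnorm _ _ _); apply/funext => z /=; rewrite big_cons prk mulrC.
by congr (_ * _)%:E; apply: eq_big_seq => i si; rewrite prs.
Qed.

(** * The linear case *)

Section linear_operators.
Context (R : realType) d (X : measurableType d) (mu : {measure set X -> \bar R}).
Context d' (Y : measurableType d') (nu : {measure set Y -> \bar R}).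
Context (q p : \bar R) (q1 : 1 <= q) (p1 : 1 <= p).
Implicit Type T : LspaceType mu q1 -> LspaceType nu p1.

Definition linear_op T : Prop := forall (a : R) (f g h : LspaceType mu q1),
  {ae mu, forall x, h x = a * f x + g x}%R ->
  {ae nu, forall y, T h y = a * T f y + T g y}%R.

Definition bounded_linear_op T : Prop := exists M : R, forall f,
  'N[nu]_p[EFin \o T f] <= M%:E * 'N[mu]_q[EFin \o f].

Definition linear_norm T : \bar R :=
  ereal_sup [set 'N[nu]_p[EFin \o T f] | f in
    [set f : LspaceType mu q1 | 'N[mu]_q[EFin \o f] <= 1]].

(** The bridge along which the facts on [op_norm] pass to linear operators. *)
Definition unary_op T (F : forall i : 'I_1, LspaceType mu q1) := T (F ord0).

Lemma unary_multilinear T : linear_op T ->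
  multilinear_op (mu := fun=> mu) (q1 := fun=> q1) (unary_op T).
Proof.
move=> lT i a f g h fgh hi; rewrite [i]ord1 in hi.
have h0 : {ae mu, forall x, h ord0 x = a * f ord0 x + g ord0 x}%R.
  by apply: filterS hi => x; apply.
by apply: filterS (lT _ _ _ _ h0) => y + _.
Qed.

Lemma unary_bounded T : bounded_linear_op T ->
  bounded_op (mu := fun=> mu) (q1 := fun=> q1) (unary_op T).
Proof. by move=> [M bT]; exists M => f; rewrite big_ord1; exact: bT. Qed.

Lemma unary_norm T :
  op_norm (mu := fun=> mu) (q1 := fun=> q1) (unary_op T) = linear_norm T.
Proof.
congr ereal_sup; apply/seteqP; split => [_ [F /= F1 <-]|_ [f /= f1 <-]].
  by exists (F ord0) => //=.
by exists (fun=> f).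
Qed.

Lemma linear_norm_ge0 T : 0 <= linear_norm T.
Proof. by rewrite -unary_norm; exact: op_norm_ge0. Qed.

Lemma linear_norm_lty T : bounded_linear_op T -> linear_norm T < +oo.
Proof. by move=> bT; rewrite -unary_norm; apply: op_norm_lty; exact: unary_bounded. Qed.

End linear_operators.

Section single_inequality.
Context (R : realType) (q p : \bar R) (q1 : 1 <= q) (p1 : 1 <= p) (r : \bar R).

(** The case [m = 1] of [vector_ineq], freed of tuples over ['I_1]; [vector_ineq1P] shows the
    equivalence. *)
Definition single_ineq (n : nat) (C : R) : Prop :=
  forall d (X : measurableType d) (mu : {sigma_finite_measure set X -> \bar R})
    d' (Y : measurableType d') (nu : {sigma_finite_measure set Y -> \bar R})
    (T : LspaceType mu q1 -> LspaceType nu p1),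
    linear_op T -> bounded_linear_op T ->
    forall f : 'I_n -> LspaceType mu q1,
      'N[nu]_p[EFin \o (fun y => lr_norm r (fun k => T (f k) y))] <=
      C%:E * linear_norm T *
        'N[mu]_q[EFin \o (fun x => lr_norm r (fun k => f k x))].

(** An index of ['I_1] equals [ord0] only propositionally, so a dependent tuple is filled by
    transport along [ord1]. *)
Definition cast1 (A : 'I_1 -> Type) (x : A ord0) (i : 'I_1) : A i :=
  ecast k (A k) (esym (ord1 i)) x.

Lemma cast1E (A : 'I_1 -> Type) (x : A ord0) : cast1 x ord0 = x.
Proof. by rewrite /cast1 (eq_irrelevance (esym (ord1 ord0)) erefl). Qed.

Lemma cast1K (A : 'I_1 -> Type) (F : forall i, A i) : cast1 (F ord0) = F.
Proof.
apply: functional_extensionality_dep => i.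
by rewrite [i]ord1 cast1E.
Qed.

Lemma lr_norm_dffun1 (N : 'I_1 -> nat) (a : 'I_(N ord0) -> R) :
  lr_norm r (fun k : {dffun forall i : 'I_1, 'I_(N i)} => a (k ord0)) =
  lr_norm r a.
Proof.
apply: (@lr_norm_bij _ _ _ _
  (fun k : {dffun forall i : 'I_1, 'I_(N i)} => k ord0)).
exists (fun j => [ffun i => cast1 (A := fun i => 'I_(N i)) j i] :
   {dffun forall i : 'I_1, 'I_(N i)}) => [k|j]; last by rewrite ffunE cast1E.
by apply/ffunP => i; rewrite ffunE (cast1K (A := fun i => 'I_(N i))).
Qed.

Lemma vector_ineq1P (N : 'I_1 -> nat) (C : R) :
  vector_ineq (fun _ : 'I_1 => q1) p1 r N C <-> single_ineq (N ord0) C.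
Proof.
split=> [h d X mu d' Y nu T lT bT f|h d X mu d' Y nu T lT bT f].
  have := h (fun=> d) (fun=> X) (fun=> mu) d' Y nu (unary_op T)
    (unary_multilinear lT) (unary_bounded bT)
    (cast1 (A := fun i => 'I_(N i) -> LspaceType mu q1) f).
  rewrite big_ord1 unary_norm cast1E.
  rewrite [X in 'N[nu]__[EFin \o X] <= _ -> _]
    (_ : _ = fun y => lr_norm r (fun k => T (f k) y))//.
  apply/funext => y; rewrite -lr_norm_dffun1.
  by apply: eq_lr_norm => k; rewrite /unary_op cast1E.
pose T1 (g : LspaceType (mu ord0) q1) :=
  T (cast1 (A := fun i => LspaceType (mu i) q1) g).
have TE F : T F = T1 (F ord0).
  by rewrite /T1 (cast1K (A := fun i => LspaceType (mu i) q1)).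
have lT1 : linear_op T1.
  move=> a u v w wuv.
  pose c g := cast1 (A := fun i => LspaceType (mu i) q1) g.
  have e1 j : j != ord0 -> c v j = c u j /\ c w j = c u j by rewrite [j]ord1.
  have e2 : c w ord0 = (fun x => a * c u ord0 x + c v ord0 x)%R %[ae mu ord0].
    by rewrite /c !cast1E; apply: filterS wuv => x ->.
  by apply: filterS (lT ord0 a _ _ _ e1 e2) => y; apply.
have bT1 : bounded_linear_op T1.
  case: bT => M bT; exists M => g.
  by have := bT (cast1 (A := fun i => LspaceType (mu i) q1) g); rewrite big_ord1 cast1E.
have nT1 : op_norm T = linear_norm T1.
  congr ereal_sup; apply/seteqP; split => [_ [F /= F1 <-]|_ [g /= g1 <-]].
    by exists (F ord0) => //=; rewrite -TE.
  exists (cast1 (A := fun i => LspaceType (mu i) q1) g) => // i /=.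
  by rewrite [i]ord1 cast1E.
rewrite big_ord1 nT1.
rewrite [X in 'N[nu]__[EFin \o X]]
  (_ : _ = fun y => lr_norm r (fun k => T1 (f ord0 k) y)); first exact: h.
apply/funext => y; rewrite -lr_norm_dffun1.
by apply: eq_lr_norm => k; rewrite TE.
Qed.

End single_inequality.

(** * Tensor products of operators *)

Section linear_norm_facts.
Context (R : realType) d (X : measurableType d) (mu : {measure set X -> \bar R}).
Context d' (Y : measurableType d') (nu : {measure set Y -> \bar R}).
Context (q p : \bar R) (q1 : 1 <= q) (p1 : 1 <= p).
Context (T : LspaceType mu q1 -> LspaceType nu p1).
Context (lT : linear_op T) (bT : bounded_linear_op T).

Lemma le_linear_norm f :
  'N[nu]_p[EFin \o T f] <= linear_norm T * 'N[mu]_q[EFin \o f].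
Proof.
have := le_op_norm (fun=> f) (unary_multilinear lT) (unary_bounded bT).
by rewrite unary_norm big_ord1.
Qed.

(** The vanishing product bounds the norm of each [T (f k)]. Hence the right-hand side of a strictly
    violated inequality is never degenerate. *)
Lemma lr_norm_linear_eq0 (r : \bar R) (n : nat) (f : 'I_n -> LspaceType mu q1) :
  1 <= r ->
  linear_norm T * 'N[mu]_q[EFin \o (fun x => lr_norm r (fun k => f k x))] = 0 ->
  'N[nu]_p[EFin \o (fun y => lr_norm r (fun k => T (f k) y))] = 0.
Proof.
move=> r1 u0; apply/eqP; rewrite eq_le Lnorm_ge0 andbT.
apply: (le_trans (Lnorm_lr_norm_le _ p1 r1 _)) => [k|].
  exact: measurable_Lspace.
rewrite big1 ?mule0// => k _; apply/eqP; rewrite eq_le Lnorm_ge0 andbT -u0.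
apply: (le_trans (le_linear_norm _)); apply: lee_wpmul2l.
  exact: linear_norm_ge0.
exact: Lnorm_Lspace_le.
Qed.

End linear_norm_facts.

Section counterexamples.
Context (R : realType) (q p : \bar R) (q1 : 1 <= q) (p1 : 1 <= p) (r : \bar R).

(** A failure of [single_ineq] packed with its spaces and measures, so that one can be chosen for
    every [i] at once. *)
Record counterexample (n : nat) (C : R) := Counterexample {
  cx_d : measure_display;
  cx_X : measurableType cx_d;
  cx_mu : {sigma_finite_measure set cx_X -> \bar R};
  cx_d' : measure_display;
  cx_Y : measurableType cx_d';
  cx_nu : {sigma_finite_measure set cx_Y -> \bar R};
  cx_T : LspaceType cx_mu q1 -> LspaceType cx_nu p1;
  cx_linear : linear_op cx_T;
  cx_bounded : bounded_linear_op cx_T;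
  cx_f : 'I_n -> LspaceType cx_mu q1;
  cx_gt : C%:E * linear_norm cx_T *
      'N[cx_mu]_q[EFin \o (fun x => lr_norm r (fun k => cx_f k x))] <
    'N[cx_nu]_p[EFin \o (fun y => lr_norm r (fun k => cx_T (cx_f k) y))]
}.

Lemma not_single_ineq n C : ~ single_ineq q1 p1 r n C ->
  exists _ : counterexample n C, True.
Proof.
move=> nh; apply: contrapT => nc; apply: nh => d X mu d' Y nu T lT bT f.
rewrite leNgt; apply/negP => gt; apply: nc.
by exists (Counterexample lT bT gt).
Qed.

End counterexamples.

Arguments cx_linear {R q p q1 p1 r n C} c.
Arguments cx_bounded {R q p q1 p1 r n C} c.

Section tensor_operator.
Context (R : realType) (m : nat) (q : 'I_m -> \bar R) (p : \bar R).
Context (q1 : forall i, 1 <= q i) (p1 : 1 <= p) (r : \bar R) (r1 : 1 <= r).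

(** The inequality is tested on the tensor product of the counterexamples; the lengths [N i] may
    differ. *)
Lemma vector_ineq_ge_prod (N : 'I_m -> nat) (c : 'I_m -> R) (C : R) :
  (forall i, (0 < N i)%N) ->
  (forall i, ~ single_ineq (q1 i) p1 r (N i) (c i)) ->
  (forall i, 0 <= c i)%R -> (0 <= C)%R ->
  vector_ineq q1 p1 r N C -> (\prod_i c i <= C)%R.
Proof.
move=> N0 /(_ _)/not_single_ineq/cid nsi c0 C0 hC.
pose w i := projT1 (nsi i).
have [d' [Z [la [pr [mpr nupr Npr]]]]] :=
  tensor_space (fun i => cx_nu (w i)) p1 (index_enum_uniq 'I_m).
have {}mpr i : measurable_fun setT (pr ^~ i) by apply: mpr; rewrite mem_index_enum.
have {}nupr i (P : cx_Y (w i) -> Prop) : {ae cx_nu (w i), forall y, P y} ->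
    {ae la, forall z, P (pr z i)} by apply: nupr; rewrite mem_index_enum.
pose mu i : {sigma_finite_measure set _ -> \bar R} := cx_mu (w i).
pose t (f : forall i, LspaceType (mu i) (q1 i)) z : R :=
  (\prod_i cx_T (f i) (pr z i))%R.
have mT i (g : LspaceType (mu i) (q1 i)) :
    measurable_fun setT (cx_T g : cx_Y (w i) -> R).
  exact: measurable_Lspace.
have mt f : measurable_fun setT (t f).
  apply: measurable_prod => i _.
  exact: (measurableT_comp (mT i (f i)) (mpr i)).
have Nt f : 'N[la]_p[EFin \o t f] =
    \prod_(i < m) 'N[cx_nu (w i)]_p[EFin \o cx_T (f i)].
  exact: Npr.
have tP f : exists h : LspaceType la p1, {ae la, forall z, h z = t f z}.
  apply: LspaceP => //; rewrite Nt -ge0_fin_numE.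
    by apply: prode_fin_num => i _; exact: Lnorm_Lspace_fin_num.
  by apply: prode_ge0 => i _; exact: Lnorm_ge0.
pose T f := projT1 (cid (tP f)).
have TE f : {ae la, forall z, T f z = t f z} := projT2 (cid (tP f)).
have NT f : 'N[la]_p[EFin \o T f] =
    \prod_(i < m) 'N[cx_nu (w i)]_p[EFin \o cx_T (f i)].
  by rewrite (ae_eq_Lnorm p1 _ _ (TE f))//; exact: measurable_Lspace.
have lT : multilinear_op T.
  move=> i a f g h fgh hi.
  have hi' : {ae mu i, forall x, h i x = a * f i x + g i x}%R.
    by apply: filterS hi => x; apply.
  have li := nupr i _ (cx_linear (w i) _ _ _ _ hi').
  near=> z => _.
  rewrite (near (TE h) z)// (near (TE f) z)// (near (TE g) z)//.
  rewrite /t !(bigD1 (P := predT) i)//= (near li z)// mulrDl mulrA.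
  congr (_ * _ + _ * _)%R; apply: eq_bigr => j ji.
    by have [_ ->] := fgh j ji.
  by have [-> ->] := fgh j ji.
have L0 i : 0 <= linear_norm (cx_T (c := w i)) by exact: linear_norm_ge0.
have bT : bounded_op T.
  exists (fine (\prod_(i < m) linear_norm (cx_T (c := w i)))) => f.
  rewrite NT fineK; last first.
    apply: prode_fin_num => i _; rewrite ge0_fin_numE//.
    exact: (linear_norm_lty (cx_bounded (w i))).
  rewrite -big_split/=; apply: lee_prod => i; first exact: Lnorm_ge0.
  exact: (le_linear_norm (cx_linear (w i)) (cx_bounded (w i))).
(* The operator norm stands on the larger side, so an upper bound suffices. *)
have nT : op_norm T <= \prod_(i < m) linear_norm (cx_T (c := w i)).
  apply: ge_ereal_sup => _ [f /= f1 <-]; rewrite NT.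
  apply: lee_prod => i; first exact: Lnorm_ge0.
  by apply: ereal_sup_ubound; exists (f i) => //; exact: f1.
pose f i := cx_f (w i).
pose S i := 'N[mu i]_(q i)[EFin \o (fun x => lr_norm r (fun k => f i k x))].
pose L i := 'N[cx_nu (w i)]_p[EFin \o (fun y => lr_norm r (fun k => cx_T (f i k) y))].
have S0 i : 0 <= S i by exact: Lnorm_ge0.
have := hC _ _ mu _ _ la T lT bT f.
(* The left-hand side factors: [T] agrees with [t] almost everywhere for the finitely many [k]
   simultaneously, then [lr_norm_prod] applies pointwise and [Npr] to the norm. *)
rewrite (_ : 'N[la]_p[_] = \prod_(i < m) L i); last first.
  rewrite -Npr; last first.
    by move=> i; apply: measurable_lr_norm => k; exact: measurable_Lspace.
  apply: ae_eq_Lnorm => //.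
  - by apply: measurable_lr_norm => k; exact: measurable_Lspace.
  - apply: measurable_prod => i _.
    have mL : measurable_fun setT (fun y => lr_norm r (fun k => cx_T (f i k) y)).
      by apply: measurable_lr_norm => k; exact: measurable_Lspace.
    exact: (measurableT_comp mL (mpr i)).
  have TEk : {ae la, forall z, forall k : {dffun forall i, 'I_(N i)},
      T (fun i => f i (k i)) z = t (fun i => f i (k i)) z}.
    by apply: filter_forall => k; exact: TE.
  apply: filterS TEk => z TEz.
  under eq_lr_norm do rewrite TEz /t.
  exact: (lr_norm_prod (fun i k => cx_T (f i k) (pr z i))).
rewrite -/(S _) => LCS.
pose u i := linear_norm (cx_T (c := w i)) * S i.
have u_fin i : u i \is a fin_num.
  rewrite fin_numM// ge0_fin_numE//.
    exact: (linear_norm_lty (cx_bounded (w i))).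
  exact: Lnorm_lr_norm_lty.
have cuL i : (c i)%:E * u i < L i by rewrite muleA; exact: cx_gt.
(* If [u i] were 0, the strict inequality of the counterexample would read [0 < 0]; positivity
   allows the final cancellation. *)
have u0 i : 0 < u i.
  rewrite lt0e mule_ge0// andbT; apply/eqP => ui0.
  have := cuL i; rewrite ui0 mule0.
  rewrite /L (lr_norm_linear_eq0 (cx_linear (w i)) (cx_bounded (w i)) r1 ui0).
  by rewrite ltxx.
have : \prod_(i < m) ((c i)%:E * u i) <= C%:E * \prod_(i < m) u i.
  apply: (@le_trans _ _ (\prod_(i < m) L i)).
    apply: lee_prod => i; last exact: ltW.
    by rewrite mule_ge0 ?lee_fin// ltW.
  apply: (le_trans LCS); rewrite /u big_split/= muleA.
  apply: lee_wpmul2r; first by apply: prode_ge0 => i _; exact: S0.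
  by apply: lee_wpmul2l; rewrite ?lee_fin.
rewrite big_split/= prodEFin.
have -> : \prod_(i < m) u i = (\prod_i fine (u i))%:E.
  by rewrite -prodEFin; apply: eq_bigr => i _; rewrite fineK.
rewrite -!EFinM lee_fin ler_pM2r//; apply: prodr_gt0 => i _.
by rewrite fine_gt0// u0/= -ge0_fin_numE ?u_fin// ltW.
Unshelve. all: by end_near. Qed.

End tensor_operator.

(** On the one-point space the identity has norm at most 1; for [n] copies of the constant 1 both
    mixed norms equal the same [b > 0]. *)
Lemma single_ineq_ge1 (R : realType) (q p : \bar R) (q1 : 1 <= q) (p1 : 1 <= p)
    (r : \bar R) (n : nat) (C : R) : 1 <= r -> (0 < n)%N ->
  single_ineq q1 p1 r n C -> (1 <= C)%R.
Proof.
move=> r1 n0 hC.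
pose mu : {sigma_finite_measure set unit -> \bar R} := \d_tt.
have TP (f : LspaceType mu q1) :
    exists h : LspaceType mu p1, {ae mu, forall x, h x = f x}.
  apply: LspaceP; first exact: measurable_Lspace.
  by rewrite Lnorm_dirac_unit// ltry.
pose T f := projT1 (cid (TP f)).
have TE f : {ae mu, forall x, T f x = f x} := projT2 (cid (TP f)).
have NT f : 'N[mu]_p[EFin \o T f] = 'N[mu]_q[EFin \o f].
  rewrite (ae_eq_Lnorm p1 _ _ (TE f)); try exact: measurable_Lspace.
  by rewrite !Lnorm_dirac_unit.
have lT : linear_op T.
  move=> a f g h hfg; near=> x.
  by rewrite (near (TE f) x)// (near (TE g) x)// (near (TE h) x)// (near hfg x).
have bT : bounded_linear_op T by exists 1%R => f; rewrite NT mul1e.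
have nT : linear_norm T <= 1.
  by apply: ge_ereal_sup => _ [f /= f1 <-]; rewrite NT.
have [f fE] : exists h : LspaceType mu q1, {ae mu, forall x, h x = 1%R}.
  apply: LspaceP; first exact: measurable_cst.
  by rewrite Lnorm_dirac_unit// ltry.
pose b : R := lr_norm r (fun _ : 'I_n => 1%R).
have b0 : (0 < b)%R by apply: (lr_norm_gt0 (k := Ordinal n0)); rewrite ?oner_neq0.
have := hC _ _ mu _ _ mu T lT bT (fun=> f).
rewrite (@ae_eq_Lnorm _ _ _ _ _ p1 _ (fun=> b)); last 3 first.
- by apply: measurable_lr_norm => k; exact: measurable_Lspace.
- exact: measurable_cst.
- near=> x; apply: eq_lr_norm => k.
  by rewrite (near (TE f) x)// (near fE x).
rewrite [X in _ <= _ * X](@ae_eq_Lnorm _ _ _ _ _ q1 _ (fun=> b)); last 3 first.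
- by apply: measurable_lr_norm => k; exact: measurable_Lspace.
- exact: measurable_cst.
- by near=> x; apply: eq_lr_norm => k; rewrite (near fE x).
rewrite !Lnorm_dirac_unit// (gtr0_norm b0) => hb.
(* [single_ineq] allows negative [C]; such a constant would make [b] nonpositive. *)
have [C0|C0] := leP 0%R C; last first.
  have : b%:E <= 0.
    apply: (le_trans hb); apply: mule_le0_ge0; last by rewrite lee_fin ltW.
    by apply: mule_le0_ge0; [rewrite lee_fin ltW|exact: linear_norm_ge0].
  by rewrite lee_fin leNgt b0.
have : b%:E <= C%:E * b%:E.
  apply: (le_trans hb); apply: lee_wpmul2r; first by rewrite lee_fin ltW.
  by rewrite -[leRHS]mule1; apply: lee_wpmul2l; rewrite ?lee_fin.
by rewrite -EFinM lee_fin ler_pMl.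
Unshelve. all: by end_near. Qed.

(** * Families of operators as one operator *)

Section power_integral.
Context (R : realType) d (Y : measurableType d) (nu : {measure set Y -> \bar R}).
Context (s : R) (s1 : (1 <= s)%R).

Definition power_integral (g : Y -> R) : \bar R := \int[nu]_y (`|g y| `^ s)%:E.

Let s0 : (0 < s)%R. Proof. exact: lt_le_trans s1. Qed.

Lemma power_integralE g : power_integral g = 'N[nu]_s%:E[EFin \o g] `^ s.
Proof. by rewrite poweR_Lnorm ?gt_eqF. Qed.

Lemma Lnorm_le_power g y : 0 <= y ->
  ('N[nu]_s%:E[EFin \o g] <= y) = (power_integral g <= y `^ s).
Proof.
move=> y0; rewrite power_integralE; apply/idP/idP => h.
  apply: gt0_ler_poweR => //; first exact: ltW.
  - by rewrite in_itv/= leey andbT Lnorm_ge0.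
  - by rewrite in_itv/= leey andbT.
have ss x : 0 <= x -> x = (x `^ s) `^ s^-1.
  by move=> x0; rewrite -poweRrM mulfV ?gt_eqF// poweRe1.
rewrite [leRHS]ss// [leLHS]ss ?Lnorm_ge0//.
apply: gt0_ler_poweR => //; first by rewrite invr_ge0 ltW.
- by rewrite in_itv/= leey andbT poweR_ge0.
- by rewrite in_itv/= leey andbT poweR_ge0.
Qed.

(** Here the equality of the two exponents enters: the outer root cancels against the power, and the
    integral is additive. *)
Lemma power_integral_lr_norm (I : finType) (G : I -> Y -> R) :
  (forall i, measurable_fun setT (G i)) ->
  power_integral (fun y => lr_norm s%:E (G ^~ y)) = \sum_i power_integral (G i).
Proof.
move=> mG; rewrite /power_integral -ge0_integral_sum//.
- apply: eq_integral => y _; rewrite /= ger0_norm ?powR_ge0// -powRrM mulVf ?gt_eqF//.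
  rewrite powRr1 ?sumEFin//.
  by apply: sumr_ge0 => i _; exact: powR_ge0.
- by move=> i; exact: measurable_power.
Qed.

Lemma ae_eq_power_integral g h : measurable_fun setT g -> measurable_fun setT h ->
  {ae nu, forall y, g y = h y} -> power_integral g = power_integral h.
Proof.
by move=> mg mh gh; rewrite !power_integralE (ae_eq_Lnorm _ mg mh gh)// lee_fin.
Qed.

End power_integral.

(* The library only provides a sigma-finite content structure on [counting]. *)
HB.instance Definition _ (R : realType) :=
  Measure_isSigmaFinite.Build _ nat R (@counting nat R) (sigma_finite_counting R).

Section vector_extension.
Context (R : realType) (q : \bar R) (q1 : 1 <= q) (s : R) (s1 : 1 <= s%:E).
Context d (X : measurableType d) (mu : {sigma_finite_measure set X -> \bar R}).
Context d' (Y : measurableType d') (nu : {sigma_finite_measure set Y -> \bar R}).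

Let s1' : (1 <= s)%R. Proof. by move: s1; rewrite lee_fin. Qed.

Let cnt : {sigma_finite_measure set nat -> \bar R} := @counting nat R.

Local Notation la := (sprod nu cnt).

(** Places [g j] on level [j] and zero on the levels from [K] on, embedding a finite $\ell^s$-sum of
    copies of $L^s(\nu)$ into $L^s$ of the product with counting measure. *)
Definition stack (K : nat) (g : 'I_K -> Y -> R) (z : Y * nat) : R :=
  (\sum_(j < K) g j z.1 * (z.2 == j)%:R)%R.

Lemma stackE K (g : 'I_K -> Y -> R) y (j : 'I_K) : stack g (y, val j) = g j y.
Proof.
rewrite /stack (bigD1 j)//= eqxx mulr1 big1 ?addr0// => i ij.
by rewrite (_ : _ == _ = false) ?mulr0//; apply/negbTE; rewrite eq_sym.
Qed.

Lemma stack_out K (g : 'I_K -> Y -> R) y n : (K <= n)%N -> stack g (y, n) = 0%R.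
Proof.
move=> Kn; rewrite /stack big1// => i _ /=.
by rewrite (_ : _ == _ = false) ?mulr0//; apply/negbTE; rewrite gtn_eqF// (leq_trans _ Kn).
Qed.

Lemma measurable_stack K (g : 'I_K -> Y -> R) :
  (forall j, measurable_fun setT (g j)) -> measurable_fun setT (stack g).
Proof.
move=> mg; apply: measurable_sum => j; apply: measurable_funM.
  exact: (measurableT_comp (mg j) measurable_fst).
have mj : measurable_fun setT (fun n : nat => (n == j)%:R : R) by [].
exact: (measurableT_comp mj measurable_snd).
Qed.

Lemma power_integral_stack K (g : 'I_K -> Y -> R) :
  (forall j, measurable_fun setT (g j)) ->
  power_integral la s (stack g) = \sum_(j < K) power_integral nu s (g j).
Proof.
move=> mg; rewrite /power_integral.
have h := @fubini_tonelli2 _ _ _ _ R nu cnt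
  (fun z => (`|stack g z| `^ s)%:E).
rewrite [LHS]h; last 2 first.
- by apply: measurable_power; exact: measurable_stack.
- by move=> z; rewrite lee_fin powR_ge0.
rewrite ge0_integral_count; last first.
  by move=> n; apply: integral_ge0 => y _; rewrite lee_fin powR_ge0.
rewrite (nneseries_split 0 K); last first.
  by move=> n _; apply: integral_ge0 => y _; rewrite lee_fin powR_ge0.
rewrite add0n eseries0 ?adde0; last first.
  move=> n Kn _; rewrite /fubini_G; under eq_integral do rewrite stack_out//.
  rewrite normr0 powR0 ?integral0// gt_eqF//; exact: lt_le_trans s1'.
rewrite big_mkord; apply: eq_bigr => j _; rewrite /fubini_G.
by apply: eq_integral => y _; rewrite stackE.
Qed.

(** The [U j] are stacked into one operator [T]; the bound on the sums over [j] says that [T] has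
    norm at most [M], and [single_ineq] for [T] is the conclusion raised to the power [s]. *)
Lemma vector_extension (n K : nat) (c M : R)
    (U : 'I_K -> LspaceType mu q1 -> LspaceType nu s1)
    (f : 'I_n -> LspaceType mu q1) :
  single_ineq q1 s1 s%:E n c -> (0 <= c)%R -> (0 <= M)%R ->
  (forall j, linear_op (U j)) ->
  (forall h, \sum_(j < K) power_integral nu s (U j h) <=
             (M%:E * 'N[mu]_q[EFin \o h]) `^ s) ->
  \sum_(k < n) \sum_(j < K) power_integral nu s (U j (f k)) <=
  (c%:E * M%:E * 'N[mu]_q[EFin \o (fun x => lr_norm s%:E (fun k => f k x))]) `^ s.
Proof.
move=> hc c0 M0 lU hM.
have mU j h : measurable_fun setT (U j h : Y -> R) by exact: measurable_Lspace.
have mS h : measurable_fun setT (stack (fun j => U j h)) by exact: measurable_stack.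
have NS h : 'N[la]_s%:E[EFin \o stack (fun j => U j h)] <= M%:E * 'N[mu]_q[EFin \o h].
  rewrite Lnorm_le_power//; last first.
    by apply: mule_ge0; [rewrite lee_fin|exact: Lnorm_ge0].
  by rewrite power_integral_stack.
have TP h : exists g : LspaceType la s1,
    {ae la, forall z, g z = stack (fun j => U j h) z}.
  apply: LspaceP => //; apply: (le_lt_trans (NS h)).
  by rewrite lte_mul_pinfty ?lee_fin// Lnorm_Lspace_lty.
pose T h := projT1 (cid (TP h)).
have TE h : {ae la, forall z, T h z = stack (fun j => U j h) z} := projT2 (cid (TP h)).
have mT h : measurable_fun setT (T h : Y * nat -> R) by exact: measurable_Lspace.
have NT h : 'N[la]_s%:E[EFin \o T h] <= M%:E * 'N[mu]_q[EFin \o h].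
  by rewrite (ae_eq_Lnorm s1 _ _ (TE h)).
have lT : linear_op T.
  move=> a u v w wuv.
  have lj : {ae la, forall z : Y * nat, forall j,
      U j w z.1 = a * U j u z.1 + U j v z.1}%R.
    apply: filter_forall => j.
    exact: (ae_fst _ (lU j a u v w wuv)).
  near=> z; rewrite (near (TE u) z)// (near (TE v) z)// (near (TE w) z)//.
  rewrite /stack mulr_sumr -big_split/=; apply: eq_bigr => j _.
  by rewrite (near lj z)// mulrDl mulrA.
have bT : bounded_linear_op T by exists M.
have nT : linear_norm T <= M%:E.
  apply: ge_ereal_sup => _ [h /= h1 <-]; apply: (le_trans (NT h)).
  by rewrite -[leRHS]mule1; apply: lee_wpmul2l.
have Nf0 := Lnorm_ge0 mu q (EFin \o (fun x => lr_norm s%:E (fun k => f k x))).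
under eq_bigr do rewrite -power_integral_stack//.
under eq_bigr => k _ do
  rewrite -(ae_eq_power_integral s1' (mT (f k)) (mS (f k)) (TE (f k))).
rewrite -power_integral_lr_norm// -Lnorm_le_power//; last first.
  apply: mule_ge0; last exact: Lnorm_ge0.
  by rewrite -EFinM lee_fin mulr_ge0.
apply: (le_trans (hc _ _ mu _ _ la T lT bT f)).
by apply: lee_wpmul2r => //; apply: lee_wpmul2l; rewrite ?lee_fin.
Unshelve. all: by end_near. Qed.

End vector_extension.

(** * Summation over one variable after the other *)

Lemma sum_enum_val (R : realType) (I : finType) (P : pred I) (F : I -> \bar R) :
  \sum_(i | P i) F i = \sum_(l < #|P|) F (enum_val l).
Proof. by rewrite -(big_enum_val F). Qed.

Section iterated_extension.
Context (R : realType) (m : nat) (q : 'I_m -> \bar R).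
Context (q1 : forall i, 1 <= q i) (s : R) (s1 : 1 <= s%:E).
Context (d : 'I_m -> measure_display) (X : forall i, measurableType (d i)).
Context (mu : forall i, {sigma_finite_measure set (X i) -> \bar R}).
Context (d' : measure_display) (Y : measurableType d').
Context (nu : {sigma_finite_measure set Y -> \bar R}).
Context (T : (forall i, LspaceType (mu i) (q1 i)) -> LspaceType nu s1).
Context (lT : multilinear_op T) (bT : bounded_op T).
Context (N : 'I_m -> nat) (c : 'I_m -> R).
Context (f : forall i, 'I_(N i) -> LspaceType (mu i) (q1 i)).
Context (k0 : {dffun forall i, 'I_(N i)}).

Let s1' : (1 <= s)%R. Proof. by move: s1; rewrite lee_fin. Qed.

Local Notation idx := {dffun forall i, 'I_(N i)}.
Local Notation vec := (forall i, LspaceType (mu i) (q1 i)).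

Let S i := 'N[mu i]_(q i)[EFin \o (fun x => lr_norm s%:E (fun k => f k x))].

(* The variables of rank less than [t] run over the families [f], the others are
   frozen at [g]; [frozen t k] keeps a single index for each frozen variable. *)
Definition frozen (t : nat) (k : idx) : bool :=
  [forall i : 'I_m, (t <= i)%N ==> (k i == k0 i)].

Definition partial_family (t : nat) (k : idx) (g : vec) : vec :=
  fun i => if (i < t)%N then f (k i) else g i.

Definition set_index (k : idx) (i : 'I_m) (j : 'I_(N i)) : idx :=
  [ffun l => eqtype.dfwith k j l].

Lemma set_index_in k i (j : 'I_(N i)) : set_index k j i = j.
Proof. by rewrite ffunE eqtype.dfwith_in. Qed.

Lemma set_index_out k i (j : 'I_(N i)) l : l != i -> set_index k j l = k l.
Proof. by move=> li; rewrite ffunE eqtype.dfwith_out// eq_sym. Qed.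

(** An index frozen from [t.+1] on is [set_index k j] for exactly one [j] and one [k] frozen from
    [t] on; the inverse restores [k0 t] at coordinate [t]. *)
Lemma sum_frozenS (t : 'I_m) (G : idx -> \bar R) :
  \sum_(k | frozen t.+1 k) G k =
  \sum_(j < N t) \sum_(k | frozen t k) G (set_index k j).
Proof.
rewrite (partition_big (fun k : idx => k t) predT)//=; apply: eq_bigr => j _.
rewrite (reindex_onto (fun k => set_index k j) (fun k => set_index k (k0 t))); last first.
  move=> k /andP[_ /eqP kt]; apply/ffunP => l.
  have [->|lt] := eqVneq l t; first by rewrite set_index_in.
  by rewrite !set_index_out.
apply: eq_bigl => k; rewrite set_index_in eqxx andbT.
apply/andP/forallP => [[/forallP fk /eqP kk] l|fk].
  have [->|lt] := eqVneq l t.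
    by rewrite -kk set_index_in eqxx implybT.
  apply/implyP => tl; have := fk l; rewrite set_index_out// => /implyP; apply.
  by rewrite ltn_neqAle tl andbT eq_sym.
split; last first.
  apply/eqP/ffunP => l; have [->|lt] := eqVneq l t; last by rewrite !set_index_out.
  by rewrite set_index_in; have := fk t; rewrite leqnn => /eqP.
apply/forallP => l; apply/implyP => tl.
rewrite set_index_out; last by apply: contraTneq tl => ->; rewrite ltnn.
by have := fk l; rewrite ltnW.
Qed.

(** Interpolates between the operator norm estimate at [t = 0] and the vector-valued bound at
    [t = m]. *)
Definition partial_bound (t : nat) (g : vec) : \bar R :=
  op_norm T *
  \prod_(i < m) (if (i < t)%N then (c i)%:E * S i else 'N[mu i]_(q i)[EFin \o g i]).

(** Induction on [t] for all [g]: with a free function [h] put in variable [t], the induction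
    hypothesis is the norm bound that [vector_extension] demands. *)
Lemma partial_family_power_le (t : nat) :
  (forall i, single_ineq (q1 i) s1 s%:E (N i) (c i)) -> (forall i, 0 <= c i)%R ->
  (t <= m)%N -> forall g : vec,
  \sum_(k | frozen t k) power_integral nu s (T (partial_family t k g)) <=
  partial_bound t g `^ s.
Proof.
move=> hc c0.
have S0 i : 0 <= S i by exact: Lnorm_ge0.
have S_fin i : S i \is a fin_num by rewrite ge0_fin_numE// Lnorm_lr_norm_lty.
elim: t => [_ g|t ih tm g].
  (* At [t = 0] every variable is frozen, so [k0] is the only index and [le_op_norm] applies. *)
  rewrite (big_pred1 k0); last first.
    move=> k; apply/forallP/eqP => [fk|->] ; last by move=> i; rewrite eqxx implybT.
    by apply/ffunP => i; have := fk i; rewrite leq0n => /eqP.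
  rewrite -Lnorm_le_power//; first exact: le_op_norm.
  by rewrite mule_ge0 ?op_norm_ge0//; apply: prode_ge0 => i _; exact: Lnorm_ge0.
pose i0 : 'I_m := Ordinal tm.
pose upd (h : LspaceType (mu i0) (q1 i0)) : vec := eqtype.dfwith g h.
have updE h : upd h i0 = h by rewrite /upd eqtype.dfwith_in.
have updN h i : i != i0 -> upd h i = g i.
  by move=> ii0; rewrite /upd eqtype.dfwith_out// eq_sym.
pose W (i : 'I_m) : \bar R :=
  if (i < t)%N then (c i)%:E * S i else 'N[mu i]_(q i)[EFin \o g i].
have W0 i : 0 <= W i.
  by rewrite /W; case: ifP => _; [rewrite mule_ge0 ?lee_fin|exact: Lnorm_ge0].
have W_fin i : W i \is a fin_num.
  by rewrite /W; case: ifP => _; [rewrite fin_numM|exact: Lnorm_Lspace_fin_num].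
(* All factors of the bound except that of [i0]; they are the same at stages [t] and [t.+1]. *)
pose M : \bar R := op_norm T * \prod_(i < m | i != i0) W i.
have M_fin : M \is a fin_num.
  rewrite fin_numM ?op_norm_fin_num//.
  by apply: prode_fin_num => i _.
have M0 : 0 <= M.
  by rewrite mule_ge0 ?op_norm_ge0//; apply: prode_ge0 => i _.
have bndt h : partial_bound t (upd h) = (fine M)%:E * 'N[mu i0]_(q i0)[EFin \o h].
  rewrite /partial_bound (bigD1 i0)//= ltnn updE fineK// muleCA [RHS]muleC.
  congr (_ * (_ * _)); apply: eq_bigr => i ii0; rewrite /W updN//.
have bndtS : partial_bound t.+1 g = (c i0)%:E * (fine M)%:E * S i0.
  rewrite /partial_bound (bigD1 i0)//= ltnSn fineK// muleCA muleAC.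
  congr (_ * (_ * _) * _); apply: eq_bigr => i ii0; rewrite /W ltnS leq_eqVlt.
  by rewrite (_ : (i == t :> nat) = false)//; apply/negbTE; apply: contra ii0.
rewrite bndtS (sum_frozenS i0).
have famS k j : frozen t k ->
    partial_family t.+1 (set_index (i := i0) k j) g = partial_family t k (upd (f j)).
  move=> fk; apply: functional_extensionality_dep => i; rewrite /partial_family.
  have [->|ii0] := eqVneq i i0; first by rewrite ltnSn set_index_in ltnn updE.
  rewrite set_index_out// updN// ltnS leq_eqVlt.
  by rewrite (_ : (i == t :> nat) = false)//; apply/negbTE; apply: contra ii0.
(* One linear operator in the variable [i0] for each index frozen at stage [t], numbered by
   [enum_val]. *)
pose U (l : 'I_#|frozen t|) h := T (partial_family t (enum_val l) (upd h)).
have lU l : linear_op (U l).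
  move=> a u v w wuv; rewrite /U.
  have e1 j : j != i0 ->
      partial_family t (enum_val l) (upd v) j = partial_family t (enum_val l) (upd u) j /\
      partial_family t (enum_val l) (upd w) j = partial_family t (enum_val l) (upd u) j.
    by move=> ji; rewrite /partial_family !updN.
  have e2 : partial_family t (enum_val l) (upd w) i0 = (fun x =>
      a * partial_family t (enum_val l) (upd u) i0 x +
      partial_family t (enum_val l) (upd v) i0 x)%R %[ae mu i0].
    by rewrite /partial_family ltnn !updE; apply: filterS wuv => x ->.
  by apply: filterS (lT e1 e2) => y; apply.
have hU h : \sum_(l < #|frozen t|) power_integral nu s (U l h) <=
    ((fine M)%:E * 'N[mu i0]_(q i0)[EFin \o h]) `^ s.
  rewrite -bndt; apply: le_trans (ih (ltnW tm) (upd h)).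
  by rewrite (sum_enum_val (frozen t)).
have := vector_extension (f (i := i0)) (hc i0) (c0 i0) (fine_ge0 M0) lU hU.
apply: le_trans; rewrite le_eqVlt; apply/orP; left; apply/eqP.
apply: eq_bigr => j _.
rewrite -(sum_enum_val (frozen t)
  (fun k => power_integral nu s (T (partial_family t k (upd (f j)))))).
by apply: eq_bigr => k fk; rewrite famS.
Qed.

End iterated_extension.

(** For finite [p] this is stage [t = m] of [partial_family_power_le] after taking roots. For
    [p = +oo] the operator norm estimate suffices, since the product of the [c i] is at least 1. *)
Lemma vector_ineq_prod (R : realType) (m : nat) (q : 'I_m -> \bar R) (p : \bar R)
    (q1 : forall i, 1 <= q i) (p1 : 1 <= p) (N : 'I_m -> nat) (c : 'I_m -> R) :
  (forall i, (0 < N i)%N) ->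
  (forall i, single_ineq (q1 i) p1 p (N i) (c i)) ->
  vector_ineq q1 p1 p N (\prod_i c i)%R.
Proof.
move=> N0 hc d X mu d' Y nu T lT bT f.
have c1 i : (1 <= c i)%R by exact: single_ineq_ge1 (hc i).
have c0 i : (0 <= c i)%R by rewrite (le_trans _ (c1 i)).
pose S (p : \bar R) i := 'N[mu i]_(q i)[EFin \o (fun x => lr_norm p (fun k => f i k x))].
have S0 r i : 0 <= S r i by exact: Lnorm_ge0.
case: p p1 hc T lT bT => [s||//] p1 hc T lT bT.
  pose k0 : {dffun forall i, 'I_(N i)} := [ffun i => Ordinal (N0 i)].
  have mT g : measurable_fun setT (T g : Y -> R) by exact: measurable_Lspace.
  have := partial_family_power_le lT bT f k0 hc c0 (leqnn m) (fun i => f i (k0 i)).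
  rewrite /partial_bound (_ : \prod_(i < m) _ =
    (\prod_i c i)%:E * \prod_(i < m) S s%:E i); last first.
    rewrite -prodEFin -big_split/=; apply: eq_bigr => i _.
    by rewrite ltn_ord.
  rewrite muleA [op_norm T * _]muleC.
  have s1 : (1 <= s)%R by rewrite -lee_fin.
  pose G (k : {dffun forall i, 'I_(N i)}) : Y -> R := T (fun i => f i (k i)).
  rewrite (_ : \sum_(k | _) _ = \sum_k power_integral nu s (G k)); last first.
    apply: eq_big => [k|k _].
      by apply/forallP => i; rewrite leqNgt ltn_ord.
    congr (power_integral _ _ (aqEqMfun_to_fun (T _))).
    by apply: functional_extensionality_dep => i; rewrite /partial_family ltn_ord.
  rewrite -(@power_integral_lr_norm _ _ _ _ _ s1 _ G (fun k => mT _)).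
  rewrite -(Lnorm_le_power _ s1)//.
  - rewrite !mule_ge0 ?op_norm_ge0//; last by apply: prode_ge0 => i _; exact: S0.
    by rewrite lee_fin prodr_ge0.
have P1 : (1 <= \prod_i c i)%R by elim/big_ind: _ => //; exact: mulr_ege1.
set B := leRHS.
have B0 : 0 <= B.
  rewrite !mule_ge0 ?op_norm_ge0//; last by apply: prode_ge0 => i _; exact: S0.
  by rewrite lee_fin (le_trans ler01).
(* For [p = +oo] the pointwise maximum dominates each member of the family, so every value of [T]
   obeys the same bound [B]. *)
have TB (k : {dffun forall i, 'I_(N i)}) :
    'N[nu]_+oo[EFin \o T (fun i => f i (k i))] <= B.
  apply: (le_trans (le_op_norm _ lT bT)); rewrite /B -muleA.
  apply: (@le_trans _ _ (op_norm T * \prod_(i < m) S +oo i)).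
    apply: lee_wpmul2l; first exact: op_norm_ge0.
    apply: lee_prod => i; first exact: Lnorm_ge0.
    exact: (Lnorm_Lspace_le p1 (f i)).
  rewrite -[leLHS]mul1e; apply: lee_wpmul2r; last by rewrite lee_fin.
  by rewrite mule_ge0 ?op_norm_ge0//; apply: prode_ge0 => i _; exact: S0.
clearbody B; rewrite unlock /=; case: ifPn => // nu0.
(* Finitely many exceptional null sets are merged, which bounds the maximum over [k] almost
   everywhere. *)
apply/ess_supP; have aek : {ae nu, forall y, forall k : {dffun forall i, 'I_(N i)},
    `|T (fun i => f i (k i)) y|%:E <= B}.
  apply: filter_forall => k; apply/ess_supP.
  by have := TB k; rewrite unlock /= nu0.
apply: filterS aek => y yB /=.
rewrite ger0_norm; last by rewrite bigmax_ge_id.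
elim/big_ind: _ => [//|x z xB zB|k _]; last exact: yB.
by rewrite maxEle; case: ifP.
Qed.

(** * The constants as infima *)

Section constants_as_infima.
Context (R : realType) (q p : \bar R) (q1 : 1 <= q) (p1 : 1 <= p) (r : \bar R).
Context (r1 : 1 <= r).

(** The sign condition on [C] may be omitted because [single_ineq_ge1] implies it. *)
Lemma kconstn1E (n : nat) : (0 < n)%N ->
  kconstn1 q1 p1 r n = ereal_inf [set C%:E | C in single_ineq q1 p1 r n].
Proof.
move=> n0; congr (ereal_inf (image _ _)); apply/seteqP; split => C /=.
  by move=> [_ /vector_ineq1P].
move=> hC; split; last by apply/(vector_ineq1P q1 p1 r (fun=> n)).
by rewrite (le_trans ler01)// (single_ineq_ge1 r1 n0 hC).
Qed.

Lemma kconst1E : kconst1 q1 p1 r = ereal_inf [set C%:E | C in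
  [set C | (1 <= C)%R /\ forall n, (0 < n)%N -> single_ineq q1 p1 r n C]].
Proof.
congr (ereal_inf (image _ _)); apply/seteqP; split => C /= -[C1 hC]; split => //.
  move=> n n0; apply/(vector_ineq1P q1 p1 r (fun=> n)); exact: hC.
by move=> N N0; apply/vector_ineq1P; exact: hC.
Qed.

Lemma kconstn1_ge1 (n : nat) : (0 < n)%N -> 1 <= kconstn1 q1 p1 r n.
Proof.
move=> n0; rewrite kconstn1E//; apply: le_ereal_inf_tmp => _ [C hC <-].
by rewrite lee_fin (single_ineq_ge1 r1 n0 hC).
Qed.

Lemma kconst1_ge1 : 1 <= kconst1 q1 p1 r.
Proof.
by rewrite kconst1E; apply: le_ereal_inf_tmp => _ [C [C1 _] <-]; rewrite lee_fin.
Qed.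

End constants_as_infima.

(** * The product of the linear constants as a lower bound *)

Section product_inequalities.
Context (R : realType) (m : nat) (p r : \bar R) (q : 'I_m -> \bar R).
Context (p1 : 1 <= p) (q1 : forall i, 1 <= q i) (r1 : 1 <= r).

(** A real [c i] strictly below the infimum violates [single_ineq], so [vector_ineq_ge_prod] bounds
    every product of such reals. *)
Lemma prod_kconstn1_le (n : nat) : (0 < n)%N ->
  \prod_(i < m) kconstn1 (q1 i) p1 r n <= kconstn q1 p1 r n.
Proof.
move=> n0; apply: le_ereal_inf_tmp => _ [C [C0 hC] <-].
rewrite -[leLHS]mule1; apply: prode_le_approx => //.
- exact: index_enum_uniq.
- by move=> i _; apply: lt_le_trans (kconstn1_ge1 _ _ r1 n0).
move=> c hc; rewrite mule1 prodEFin lee_fin.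
have {}hc i : (0 <= c i)%R /\ (c i)%:E < kconstn1 (q1 i) p1 r n.
  by apply: hc; rewrite mem_index_enum.
apply: vector_ineq_ge_prod hC => // i; last by have [] := hc i.
have [_ + hi] := hc i; rewrite kconstn1E// ltNge => /negP; apply.
by apply: ereal_inf_lbound; exists (c i).
Qed.

Lemma prod_kconst1_le : \prod_(i < m) kconst1 (q1 i) p1 r <= kconst q1 p1 r.
Proof.
apply: le_ereal_inf_tmp => _ [C [C1 hC] <-].
rewrite -[leLHS]mule1; apply: prode_le_approx => //.
- exact: index_enum_uniq.
- by move=> i _; apply: lt_le_trans (kconst1_ge1 _ _ r).
move=> c hc; rewrite mule1 prodEFin lee_fin.
have {}hc i : (0 <= c i)%R /\ (c i)%:E < kconst1 (q1 i) p1 r.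
  by apply: hc; rewrite mem_index_enum.
(* The length at which [c i] fails depends on [i]. If it never failed, length 1 would give
   [1 <= c i], and [c i] would be admissible. *)
have ex i : exists n, (0 < n)%N /\ ~ single_ineq (q1 i) p1 r n (c i).
  have [ci0 ciK] := hc i; apply: contrapT => /forallNP nex.
  have {}nex n : (0 < n)%N -> single_ineq (q1 i) p1 r n (c i).
    by move=> n0; apply: contrapT => h; apply: (nex n).
  move: ciK; rewrite kconst1E ltNge => /negP; apply.
  apply: ereal_inf_lbound; exists (c i) => //; split => //.
  exact: (single_ineq_ge1 r1 _ (nex 1%N isT)).
pose N i := projT1 (cid (ex i)).
have NP i : (0 < N i)%N /\ ~ single_ineq (q1 i) p1 r (N i) (c i) := projT2 (cid (ex i)).
apply: (@vector_ineq_ge_prod _ _ _ _ q1 p1 _ r1 N) => // [i|i|i||].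
- by have [] := NP i.
- by have [] := NP i.
- by have [] := hc i.
- by rewrite (le_trans ler01).
by apply: hC => i; have [] := NP i.
Qed.

End product_inequalities.

(** * The product of the linear constants as an upper bound when both exponents agree *)

Section product_equalities.
Context (R : realType) (m : nat) (p : \bar R) (q : 'I_m -> \bar R).
Context (p1 : 1 <= p) (q1 : forall i, 1 <= q i).

(** Products of admissible linear constants are admissible by [vector_ineq_prod]; [prode_ge_approx]
    passes to the infima. *)
Lemma kconstn_le_prod (n : nat) : (0 < n)%N ->
  kconstn q1 p1 p n <= \prod_(i < m) kconstn1 (q1 i) p1 p n.
Proof.
move=> n0; under eq_bigr do rewrite kconstn1E//.
rewrite -[leRHS]mule1; apply: prode_ge_approx => //.
- exact: index_enum_uniq.
- by move=> i c hc; exact: (single_ineq_ge1 p1 n0 hc).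
move=> c hc; rewrite mule1 prodEFin.
have {}hc i : single_ineq (q1 i) p1 p n (c i) by apply: hc; rewrite mem_index_enum.
apply: ereal_inf_lbound; exists (\prod_i c i)%R => //; split.
  apply: prodr_ge0 => i _.
  by rewrite (le_trans ler01)// (single_ineq_ge1 p1 n0 (hc i)).
exact: vector_ineq_prod.
Qed.

Lemma kconst_le_prod : kconst q1 p1 p <= \prod_(i < m) kconst1 (q1 i) p1 p.
Proof.
under eq_bigr do rewrite kconst1E.
rewrite -[leRHS]mule1; apply: prode_ge_approx => //.
- exact: index_enum_uniq.
- by move=> i c [].
move=> c hc; rewrite mule1 prodEFin.
have {}hc i : (1 <= c i)%R /\
    forall n, (0 < n)%N -> single_ineq (q1 i) p1 p n (c i).
  by apply: hc; rewrite mem_index_enum.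
apply: ereal_inf_lbound; exists (\prod_i c i)%R => //; split.
  elim/big_ind: _ => //; first exact: mulr_ege1.
  by move=> i _; have [] := hc i.
move=> N N0; apply: vector_ineq_prod => // i.
by have [_] := hc i; apply.
Qed.

End product_equalities.

Theorem proposition1p4 (R : realType) (m : nat) (p r : \bar R)
    (q : 'I_m -> \bar R) (m_gt0 : (0 < m)%N)
    (p1 : 1 <= p) (q1 : forall i, 1 <= q i) (r1 : 1 <= r) :
  [/\ forall n : nat, (0 < n)%N ->
        \prod_(i < m) kconstn1 (q1 i) p1 r n <= kconstn q1 p1 r n,
      \prod_(i < m) kconst1 (q1 i) p1 r <= kconst q1 p1 r
    & p = r ->
        (forall n : nat, (0 < n)%N ->
           \prod_(i < m) kconstn1 (q1 i) p1 r n = kconstn q1 p1 r n) /\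
        \prod_(i < m) kconst1 (q1 i) p1 r = kconst q1 p1 r].
Proof.
split => [n n0||pr]; [exact: prod_kconstn1_le|exact: prod_kconst1_le|].
rewrite -{r r1}pr; split => [n n0|]; apply/eqP; rewrite eq_le.
  by rewrite prod_kconstn1_le// kconstn_le_prod.
by rewrite prod_kconst1_le// kconst_le_prod.
Qed.
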